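(* Let $\mathbb{H}=\mathbb{R}$ or $\mathbb{C}$ and $d\ge 2$, and consider Borel probability measures on $G(1,d)$. (1) If $0<s<1$, then the invariant measure $\Gamma_{1,d}$ is the unique minimizer of $F_{\alpha_s}(\mu)=\sup_{x\in\mathbb{S}^{d-1}}\int_{G(1,d)}(1-\|P_W(x)\|^2)^s\,d\mu(W)$ over all Borel probability measures $\mu$ on $G(1,d)$. (2) The invariant measure $\Gamma_{1,d}$ is the unique minimizer of $F_{\alpha_{\log}}(\mu)=\sup_{x\in\mathbb{S}^{d-1}}\int_{G(1,d)}\log(1-\|P_W(x)\|^2)\,d\mu(W)$ over all Borel probability measures $\mu$ on $G(1,d)$.
   Context: $G(1,d)$ is the set of one-dimensional subspaces of $\mathbb{H}^d$, with metric $d(V,W)=\|P_V-P_W\|_{\mathrm{Frob}}$, where $P_V$ is the orthogonal projection onto $V$; $\mathbb{S}^{d-1}$ is the unit sphere of $\mathbb{H}^d$. $\Gamma_{1,d}$ is the unique Borel probability measure on $G(1,d)$ invariant under the orthogonal group (if $\mathbb{H}=\mathbb{R}$) or unitary group (if $\mathbb{H}=\mathbb{C}$). *)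

(* Defs.v *)
From HB Require Import structures.
From mathcomp Require Import complex.
From mathcomp Require Import all_boot all_algebra.
From mathcomp Require Import all_classical all_reals all_analysis.
Set Implicit Arguments. Unset Strict Implicit. Unset Printing Implicit Defensive.
Import GRing.Theory Num.Theory.
Local Open Scope ring_scope.
Local Open Scope classical_set_scope.

(** The scalar field H: the reals or the complexes.  Both are realised inside
    R[i]; in the real case vectors/matrices are required to have real entries. *)
Inductive Hfield := Hreal | Hcomplex.

Section G1d.
Variables (R : realType) (H : Hfield) (n : nat).
Local Notation d := n.+2.
Local Notation C := (R[i]).

Definition inH (z : C) : bool :=
  if H is Hreal then complex.Im z == 0 else true.

Definition mxH m p (A : 'M[C]_(m, p)) : bool := [forall i, forall j, inH (A i j)].

Definition adj m p (A : 'M[C]_(m, p)) : 'M[C]_(p, m) :=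
  \matrix_(i, j) Complex (complex.Re (A j i)) (- complex.Im (A j i)).

Definition is_line_proj (P : 'M[C]_d) : bool :=
  [&& mxH P, P *m P == P, adj P == P & \rank P == 1%N].

(* G(1,d), each line V being represented by its orthogonal projection P_V *)
Definition Gr1 := {P : 'M[C]_d | is_line_proj P}.

Definition P00 : 'M[C]_d := delta_mx ord0 ord0.

Lemma P00_line : is_line_proj P00.
Proof.
apply/and4P; split.
- apply/forallP => i; apply/forallP => j; rewrite /inH /P00 mxE.
  by case: H => //; case: (_ && _).
- by rewrite /P00 mul_delta_mx.
- apply/eqP/matrixP => i j; rewrite /adj /P00 !mxE.
  by case: (i == ord0); case: (j == ord0) => //=; rewrite oppr0.
- by rewrite /P00 mxrank_delta.
Qed.

HB.instance Definition _ := [Choice of Gr1 by <:].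
HB.instance Definition _ := isPointed.Build Gr1 (exist _ P00 P00_line).

Definition normsq m (v : 'cV[C]_m) : R :=
  \sum_i (complex.Re (v i ord0) ^+ 2 + complex.Im (v i ord0) ^+ 2).

Definition frob_dist (P Q : 'M[C]_d) : R :=
  Num.sqrt (\sum_i \sum_j (complex.Re (P i j - Q i j) ^+ 2
                          + complex.Im (P i j - Q i j) ^+ 2)).

Definition Gr_open (A : set Gr1) : Prop :=
  forall W, A W -> exists2 e : R, 0 < e &
    forall V : Gr1, frob_dist (sval W) (sval V) < e -> A V.

Definition GrB : measurableType (sigma_display Gr_open) :=
  g_sigma_algebraType Gr_open.

Definition sphere : set 'cV[C]_d := [set x | mxH x /\ normsq x = 1].

Definition unitary_mx (U : 'M[C]_d) : Prop := mxH U /\ adj U *m U = 1%:M.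

(* invariance of a measure under the action V |-> U V of the orthogonal /
   unitary group (on projections: P_{UV} = U P_V U^* ) *)
Definition Gr_invariant (mu : set GrB -> \bar R) : Prop :=
  forall U, unitary_mx U -> forall A : set GrB, measurable A ->
    mu [set W : GrB | exists2 V : GrB, A V & sval V = U *m sval W *m adj U]
    = mu A.

Definition alpha_s (s : R) (W : GrB) (x : 'cV[C]_d) : R :=
  (1 - normsq (sval W *m x)) `^ s.

Definition lnE (t : R) : \bar R := if t == 0 then -oo%E else (ln t)%:E.

Definition alpha_log (W : GrB) (x : 'cV[C]_d) : \bar R :=
  lnE (1 - normsq (sval W *m x)).

Definition F_s (s : R) (mu : probability GrB R) : \bar R :=
  ereal_sup [set (\int[mu]_W (alpha_s s W x)%:E)%E | x in sphere].

Definition F_log (mu : probability GrB R) : \bar R :=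
  ereal_sup [set (\int[mu]_W alpha_log W x)%E | x in sphere].

Definition unique_minimizer (F : probability GrB R -> \bar R)
    (Gam : probability GrB R) : Prop :=
  (forall nu : probability GrB R, (F Gam <= F nu)%E) /\
  (forall mu : probability GrB R, (forall nu : probability GrB R, (F mu <= F nu)%E) ->
     forall A : set GrB, measurable A -> mu A = Gam A).

End G1d.

(* Main.v *)
(* Write k(V, W) = Re tr(P_V P_W), so that ||P_W x||^2 = k(line x, W). Up to an
   additive constant both kernels are - sum_m a_m k^m with a_0 = 0 and a_m > 0
   for m >= 1. Each k^m is the Gram kernel of finitely many functions, hence the
   m-th energy E_m(mu) of any probability mu is at least that of the invariant
   measure, g_m, and equality forces int k(V, W)^m dmu(W) = g_m for all V.
   By invariance the potential sum_m a_m int k(V, W)^m dmu(W) has Gam-average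
   gamma = sum_m a_m g_m, which gives minimality of Gam. If mu is a minimizer its
   potential is at least gamma everywhere, hence equal to gamma everywhere since
   it is lower semicontinuous and balls have positive Gam-measure. Integrating
   against mu yields sum_m a_m E_m(mu) = gamma, and gamma is finite, so
   E_m(mu) = g_m for all m. Finally the kernels k^m / g_m form an approximate
   identity for mu and for Gam, so that mu = Gam on open sets. *)
Require Import Defs.
From HB Require Import structures.
From mathcomp Require Import complex.
From mathcomp Require Import all_boot all_order all_algebra.
From mathcomp Require Import all_classical all_reals all_analysis measurable_realfun.
From mathcomp Require Import ring lra.
Set Implicit Arguments.
Unset Strict Implicit.
Unset Printing Implicit Defensive.
Import Order.TTheory GRing.Theory Num.Theory.
Import numFieldNormedType.Exports.
Local Open Scope ring_scope.
Local Open Scope classical_set_scope.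

(** * Power kernels of a Gram kernel *)

(** Lines enter only as unit vectors of a finite-dimensional real space with nonnegative inner
    products, on which the unitary group acts transitively by isometries. The finite Gram
    representation of [k^m] turns energy differences into finite sums of squares and the exchange of
    two integrals into an exchange of finite sums. Series are kept in the extended reals with
    nonnegative terms. The delicate point is the finiteness of gamma: an equality of two series with
    ordered terms can be read termwise only if their sum is finite. For the power kernel the
    potential is at most 1. The logarithmic kernel is infinite on the diagonal, so a decay of [g_m]
    has to be proved. Positive definiteness bounds [g_m] above by the energy of any finite
    configuration, and well separated lines in a plane give a bound of order [m^(-1/3)], enough for
    the sum of the [g_m / m] to converge. *)

Section bounded_integrals.
Context {d : measure_display} {T : measurableType d} {R : realType}.
Implicit Types (mu : probability T R) (D : set T).

Lemma probability_integrable mu D (f : T -> R) (M : R) : measurable D ->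
  measurable_fun setT f -> (forall x, `|f x| <= M) ->
  mu.-integrable D (EFin \o f).
Proof.
move=> mD mf fM; apply: measurable_bounded_integrable => //.
- by apply: le_lt_trans (probability_le1 mu mD) _; rewrite ltry.
- exact: measurable_funS mf.
- exists M; split; first exact: num_real.
  by move=> y My x _; apply: le_trans (fM x) (ltW My).
Qed.

Lemma Rintegral_sum mu D (J : Type) (s : seq J) (f : J -> T -> R) :
  measurable D -> (forall j, mu.-integrable D (EFin \o f j)) ->
  \int[mu]_(x in D) (\sum_(j <- s) f j x) =
  \sum_(j <- s) \int[mu]_(x in D) f j x.
Proof.
move=> mD intf; elim: s => [|j s IHs].
  under eq_Rintegral do rewrite big_nil.
  by rewrite big_nil Rintegral_cst// mul0r.
under eq_Rintegral do rewrite big_cons.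
rewrite big_cons RintegralD ?IHs//.
have -> : EFin \o (fun x => \sum_(j0 <- s) f j0 x) =
    (fun x => \sum_(j0 <- s) (EFin \o f j0) x)%E.
  by apply/funext => x /=; rewrite sumEFin.
exact: integrable_sum.
Qed.

Lemma Rintegral_probability_cst mu (r : R) : \int[mu]_x r = r.
Proof.
rewrite Rintegral_cst// -[RHS]mulr1; congr (_ * _).
exact: (congr1 fine (probability_setT mu)).
Qed.

End bounded_integrals.

Section gram.
Context {d : measure_display} {T : measurableType d} {R : realType}.
Context {I : finType}.
Variable phi : I -> T -> R.
Implicit Types (mu nu Gam : probability T R) (A B : set T) (V W : T).

(** Inner product of [V] and [W] embedded by the coordinates [phi]. For lines the coordinates are
    the real and imaginary parts of the entries of the projection. *)
Definition gram V W : R := \sum_i phi i V * phi i W.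

Lemma gramC V W : gram V W = gram W V.
Proof. by apply: eq_bigr => i _; rewrite mulrC. Qed.

Hypothesis mphi : forall i, measurable_fun setT (phi i).
Hypothesis gramVV : forall V, gram V V = 1.
Hypothesis gram_ge0 : forall V W, 0 <= gram V W.

Lemma sum_sqr_sub V W :
  \sum_i (phi i V - phi i W) ^+ 2 = 2 - 2 * gram V W.
Proof.
transitivity (gram V V + gram W W - 2 * gram V W); last by rewrite !gramVV.
rewrite /gram mulr_sumr -big_split -sumrB; apply: eq_bigr => i _ /=; ring.
Qed.

Lemma gram_le1 V W : gram V W <= 1.
Proof.
have : 0 <= \sum_i (phi i V - phi i W) ^+ 2.
  by apply: sumr_ge0 => i _; exact: sqr_ge0.
by rewrite sum_sqr_sub; lra.
Qed.

Lemma phi_le1 i V : `|phi i V| <= 1.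
Proof.
rewrite -(@expr_le1 _ 2)// real_normK ?num_real// -(gramVV V) /gram.
rewrite (bigD1 i)//= -expr2 lerDl sumr_ge0// => j _.
by rewrite -expr2 sqr_ge0.
Qed.

Lemma gramX_ge0 m V W : 0 <= gram V W ^+ m.
Proof. exact: exprn_ge0. Qed.

Lemma gramX_le1 m V W : gram V W ^+ m <= 1.
Proof. by apply: exprn_ile1 => //; exact: gram_le1. Qed.

(* The [m]-th power of the kernel is again the Gram kernel of finitely many
   functions, the [m]-fold products of the [phi i]. *)
Lemma gramX_features m : exists (J : finType) (psi : J -> T -> R),
  [/\ forall j, measurable_fun setT (psi j),
      forall j V, `|psi j V| <= 1 &
      forall V W, gram V W ^+ m = \sum_j psi j V * psi j W].
Proof.
elim: m => [|m [J [psi [mpsi psi1 IH]]]].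
  exists unit, (fun _ _ => 1); split.
  - by move=> _; exact: measurable_cst.
  - by move=> _ V; rewrite normr1.
  - by move=> V W; rewrite expr0 big_const card_unit /= mulr1 addr0.
exists (I * J)%type, (fun p V => phi p.1 V * psi p.2 V); split.
- by move=> p; exact: measurable_funM.
- by move=> p V; rewrite normrM mulr_ile1// phi_le1.
- move=> V W; rewrite exprS IH /gram big_distrlr pair_big /=.
  by apply: eq_bigr => p _; rewrite mulrACA.
Qed.

Lemma measurable_gram V : measurable_fun setT (gram V).
Proof.
by apply: measurable_sum => i; apply: measurable_funM => //; exact: measurable_cst.
Qed.

Lemma measurable_gramX m V : measurable_fun setT (fun W => gram V W ^+ m).
Proof. exact/measurable_funX/measurable_gram. Qed.

Lemma integrable_gramX mu A m V : measurable A ->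
  mu.-integrable A (EFin \o (fun W => gram V W ^+ m)).
Proof.
move=> mA; apply: (@probability_integrable _ _ _ _ _ _ 1) => //.
  exact: measurable_gramX.
by move=> W; rewrite ger0_norm ?gramX_le1 ?gramX_ge0.
Qed.

Section features.
Context {m : nat} {J : finType} {psi : J -> T -> R}.
Hypothesis mpsi : forall j, measurable_fun setT (psi j).
Hypothesis psi1 : forall j V, `|psi j V| <= 1.
Hypothesis psiE : forall V W, gram V W ^+ m = \sum_j psi j V * psi j W.

Lemma integrable_psi mu A j : measurable A ->
  mu.-integrable A (EFin \o psi j).
Proof. by move=> mA; apply: (@probability_integrable _ _ _ _ _ _ 1). Qed.

Lemma Rintegral_psi_cst mu A (c : J -> R) : measurable A ->
  \int[mu]_(V in A) (\sum_j psi j V * c j) =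
  \sum_j (\int[mu]_(V in A) psi j V) * c j.
Proof.
move=> mA; rewrite Rintegral_sum//.
  by apply: eq_bigr => j _; rewrite RintegralZr//; exact: integrable_psi.
move=> j; apply: (@probability_integrable _ _ _ _ _ _ `|c j|) => //.
  by apply: measurable_funM => //; exact: measurable_cst.
by move=> V; rewrite normrM ler_piMl.
Qed.

Lemma Rintegral_gramX_psi mu A V : measurable A ->
  \int[mu]_(W in A) (gram V W ^+ m) =
  \sum_j psi j V * \int[mu]_(W in A) psi j W.
Proof.
move=> mA; under eq_Rintegral do rewrite psiE.
under eq_Rintegral do under eq_bigr do rewrite mulrC.
by rewrite Rintegral_psi_cst//; apply: eq_bigr => j _; rewrite mulrC.
Qed.

Lemma Rintegral2_gramX_psi mu nu A B : measurable A -> measurable B ->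
  \int[mu]_(V in A) (\int[nu]_(W in B) (gram V W ^+ m)) =
  \sum_j (\int[mu]_(V in A) psi j V) * (\int[nu]_(W in B) psi j W).
Proof.
move=> mA mB.
under eq_Rintegral do rewrite Rintegral_gramX_psi//.
by rewrite Rintegral_psi_cst.
Qed.

End features.

(** Fubini for a kernel of finite rank: both sides are the same finite sum of products of feature
    integrals. *)
Lemma Rintegral_gramX_exchange mu nu A B m : measurable A -> measurable B ->
  \int[mu]_(V in A) (\int[nu]_(W in B) (gram V W ^+ m)) =
  \int[nu]_(W in B) (\int[mu]_(V in A) (gram W V ^+ m)).
Proof.
have [J [psi [mpsi psi1 psiE]]] := gramX_features m => mA mB.
rewrite !(Rintegral2_gramX_psi mpsi psi1 psiE)//.
by apply: eq_bigr => j _; rewrite mulrC.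
Qed.

Definition moment m mu V : R := \int[mu]_W (gram V W ^+ m).

Lemma moment_ge0 m mu V : 0 <= moment m mu V.
Proof. by apply: Rintegral_ge0 => W _; exact: gramX_ge0. Qed.

Lemma measurable_Rintegral_gramX m mu A : measurable A ->
  measurable_fun setT (fun V => \int[mu]_(W in A) (gram V W ^+ m)).
Proof.
have [J [psi [mpsi psi1 psiE]]] := gramX_features m => mA.
rewrite (_ : (fun V => _) =
    (fun V => \sum_j psi j V * \int[mu]_(W in A) psi j W)).
  apply: measurable_sum => j.
  by apply: measurable_funM => //; exact: measurable_cst.
by apply/funext => V; rewrite (Rintegral_gramX_psi mpsi psi1 psiE).
Qed.

Lemma measurable_moment m mu : measurable_fun setT (moment m mu).
Proof. exact: measurable_Rintegral_gramX. Qed.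

Lemma EFin_moment m mu V :
  (moment m mu V)%:E = (\int[mu]_W (gram V W ^+ m)%:E)%E.
Proof.
rewrite /moment /Rintegral fineK//; apply: integrable_fin_num => //.
exact: integrable_gramX.
Qed.

Lemma moment_le1 m mu V : moment m mu V <= 1.
Proof.
rewrite -[leRHS](Rintegral_probability_cst mu); apply: le_Rintegral => //.
- exact: integrable_gramX.
- apply: (@probability_integrable _ _ _ _ _ _ 1) => // x.
  by rewrite normr1.
- by move=> W _; exact: gramX_le1.
Qed.

Lemma Rintegral_gramX_le m mu A V : measurable A ->
  \int[mu]_(W in A) (gram V W ^+ m) <= moment m mu V.
Proof.
move=> mA; rewrite /moment /Rintegral fine_le//.
- by apply: integrable_fin_num => //; exact: integrable_gramX.
- by apply: integrable_fin_num => //; exact: integrable_gramX.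
- apply: ge0_subset_integral => //.
    by apply/measurable_EFinP; exact: measurable_gramX.
  by move=> W _; rewrite lee_fin gramX_ge0.
Qed.

Lemma integrable_Rintegral_gramX m mu nu A B : measurable A -> measurable B ->
  mu.-integrable A (EFin \o (fun V => \int[nu]_(W in B) (gram V W ^+ m))).
Proof.
move=> mA mB; apply: (@probability_integrable _ _ _ _ _ _ 1) => //.
  exact: measurable_Rintegral_gramX.
move=> V; rewrite ger0_norm.
  exact: le_trans (Rintegral_gramX_le m nu V mB) (moment_le1 m nu V).
by apply: Rintegral_ge0 => W _; exact: gramX_ge0.
Qed.

(** * Energies compared with a measure of constant moment *)

Section constant_moment.
Variables (m : nat) (Gam : probability T R) (g : R).
Hypothesis momentGam : forall V, moment m Gam V = g.

Lemma Rintegral_moment_cst mu : \int[Gam]_V moment m mu V = g.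
Proof.
rewrite Rintegral_gramX_exchange//.
rewrite -[RHS](Rintegral_probability_cst mu).
by apply: eq_Rintegral => V _; exact: momentGam.
Qed.

(* The energy difference is the squared distance between the feature means. *)
Lemma energy_sub mu (J : finType) (psi : J -> T -> R) :
  (forall j, measurable_fun setT (psi j)) ->
  (forall j V, `|psi j V| <= 1) ->
  (forall V W, gram V W ^+ m = \sum_j psi j V * psi j W) ->
  \int[mu]_V moment m mu V - g =
  \sum_j (\int[mu]_V psi j V - \int[Gam]_V psi j V) ^+ 2.
Proof.
move=> mpsi psi1 psiE.
(* The mixed energy of any [nu] with [Gam] is [g], since [Gam] has constant moment. *)
have cross nu : g = \sum_j (\int[nu]_V psi j V) * (\int[Gam]_V psi j V).
  rewrite -(Rintegral2_gramX_psi mpsi psi1 psiE)//.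
  rewrite -[LHS](Rintegral_probability_cst nu).
  by apply: eq_Rintegral => V _; exact/esym/momentGam.
rewrite (Rintegral2_gramX_psi mpsi psi1 psiE)//.
(* Completes the square: the first [g] becomes the energy of [Gam], the second the mixed energy of
   [mu] and [Gam]. *)
have -> : - g = g - 2 * g by ring.
rewrite {1}(cross Gam) (cross mu) mulr_sumr -sumrB -big_split /=.
by apply: eq_bigr => j _; ring.
Qed.

Lemma energy_ge mu : g <= \int[mu]_V moment m mu V.
Proof.
have [J [psi [mpsi psi1 psiE]]] := gramX_features m.
rewrite -subr_ge0 (energy_sub _ mpsi psi1 psiE).
by apply: sumr_ge0 => j _; exact: sqr_ge0.
Qed.

(** Equality kills every square, so [mu] and [Gam] have the same feature means, and a moment depends
    on its measure only through these. *)
Lemma energy_eq mu : \int[mu]_V moment m mu V = g ->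
  forall V, moment m mu V = g.
Proof.
have [J [psi [mpsi psi1 psiE]]] := gramX_features m.
move=> /eqP; rewrite -subr_eq0 (energy_sub _ mpsi psi1 psiE).
rewrite psumr_eq0 => [/allP eq0 V|j _]; last exact: sqr_ge0.
rewrite -(momentGam V) /moment !(Rintegral_gramX_psi mpsi psi1 psiE)//.
apply: eq_bigr => j _; congr (_ * _); apply/eqP.
by rewrite -subr_eq0 -sqrf_eq0; exact: (eq0 j (mem_index_enum j)).
Qed.

(** The energy bound for [N] equally weighted points, diagonal included, again by completing a
    square. It serves to bound [g] from above by an explicit configuration. *)
Lemma discrete_energy_ge N (v : 'I_N -> T) :
  N%:R ^+ 2 * g <= \sum_i \sum_j gram (v i) (v j) ^+ m.
Proof.
have [J [psi [mpsi psi1 psiE]]] := gramX_features m.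
have crossv i : g = \sum_j psi j (v i) * (\int[Gam]_V psi j V).
  by rewrite -(momentGam (v i)) /moment (Rintegral_gramX_psi mpsi psi1 psiE).
have self : g = \sum_j (\int[Gam]_V psi j V) * (\int[Gam]_V psi j V).
  rewrite -(Rintegral2_gramX_psi mpsi psi1 psiE)//.
  rewrite -[LHS](Rintegral_probability_cst Gam).
  by apply: eq_Rintegral => V _; exact/esym/momentGam.
rewrite -subr_ge0.
have -> : \sum_i \sum_j gram (v i) (v j) ^+ m =
    \sum_k (\sum_i psi k (v i)) ^+ 2.
  under eq_bigr do under eq_bigr do rewrite psiE.
  under eq_bigr do rewrite exchange_big.
  rewrite exchange_big; apply: eq_bigr => k _ /=.
  by rewrite expr2 big_distrlr.
have cross : N%:R * g = \sum_k (\sum_i psi k (v i)) * \int[Gam]_V psi k V.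
  under eq_bigr do rewrite mulr_suml.
  rewrite exchange_big /=.
  under eq_bigr do rewrite -crossv.
  by rewrite sumr_const card_ord mulr_natl.
suff -> : \sum_k (\sum_i psi k (v i)) ^+ 2 - N%:R ^+ 2 * g =
    \sum_k (\sum_i psi k (v i) - N%:R * \int[Gam]_V psi k V) ^+ 2.
  by apply: sumr_ge0 => k _; exact: sqr_ge0.
have -> : - (N%:R ^+ 2 * g) =
    N%:R ^+ 2 * g - (2 * N%:R) * (N%:R * g) by ring.
rewrite cross {1}self !mulr_sumr -sumrB -big_split /=.
by apply: eq_bigr => k _; ring.
Qed.

End constant_moment.

(** * Balls and their mass *)

Definition gram_ball V (c : R) : set T := [set W | c < gram V W].

Lemma measurable_gram_ball V c : measurable (gram_ball V c).
Proof.
rewrite (_ : gram_ball V c = setT `&` gram V @^-1` `]c, +oo[%classic).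
  by apply: measurable_gram => //; exact: measurable_itv.
by rewrite setTI; apply/seteqP; split => W /=; rewrite in_itv /= andbT.
Qed.

(** Pigeonhole: the slices of [A] on which [f] lies in an interval of length [e] are countably many
    and cover [A], so they cannot all be null. *)
Lemma small_oscillation1 mu A (f : T -> R) (e : R) : 0 < e ->
  measurable_fun setT f -> (forall x, `|f x| <= 1) ->
  measurable A -> (0 < mu A)%E ->
  exists B, [/\ B `<=` A, measurable B, (0 < mu B)%E &
    forall x y, B x -> B y -> `|f x - f y| <= e].
Proof.
move=> e0 mf f1 mA A0; apply: contrapT => noB.
pose B n : set T := A `&` f @^-1` `[n%:R * e - 1, n.+1%:R * e - 1[%classic.
have mB n : measurable (B n).
  by apply: measurableI => //; rewrite -[X in measurable X]setTI; exact: mf.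
have B0 n : mu.-negligible (B n).
  apply/negligibleP => //; apply/eqP/negPn/negP => Bn0; apply: noB.
  exists (B n); split => //.
  - exact: subIsetl.
  - by rewrite lt0e Bn0 measure_ge0.
  - move=> x y [_ /=]; rewrite in_itv /= => /andP[x1 x2].
    move=> [_ /=]; rewrite in_itv /= => /andP[y1 y2].
    move: x2 y2; rewrite -natr1 mulrDl mul1r => x2 y2.
    by rewrite ler_norml; apply/andP; split; lra.
have : mu.-negligible A.
  apply: negligibleS (negligible_bigcup B0) => x Ax.
  have fx : 0 <= (f x + 1) / e.
    apply: divr_ge0; last exact: ltW.
    by have := f1 x; rewrite ler_norml => /andP[]; lra.
  exists (Num.truncn ((f x + 1) / e)) => //; split => //=.
  have /andP[h1 h2] := truncn_itv fx.
  rewrite in_itv /= lerBlDr ltrBrDr -ler_pdivlMr// -ltr_pdivrMr//.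
  by rewrite h1 h2.
by move/negligibleP => /(_ mA) A00; rewrite A00 ltxx in A0.
Qed.

Lemma small_oscillation mu (e : R) : 0 < e ->
  exists A, [/\ measurable A, (0 < mu A)%E &
    forall i x y, A x -> A y -> `|phi i x - phi i y| <= e].
Proof.
move=> e0.
suff [A [mA A0 HA]] : exists A, [/\ measurable A, (0 < mu A)%E &
    forall i, i \in enum I -> forall x y, A x -> A y ->
      `|phi i x - phi i y| <= e].
  by exists A; split => // i; apply: HA; rewrite mem_enum.
elim: (enum I) => [|i s [A [mA A0 HA]]].
  by exists setT; split => //; rewrite probability_setT.
have [B [BA mB B0 HB]] := small_oscillation1 e0 (mphi i) (phi_le1 i) mA A0.
exists B; split => // j; rewrite inE => /predU1P[-> //|js] x y Bx By.
by apply: HA => //; exact: BA.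
Qed.

Section uniform_balls.
Variable Gam : probability T R.
Hypothesis ball_cst : forall V V' c,
  Gam (gram_ball V c) = Gam (gram_ball V' c).

(** Some set of positive mass has small oscillation in every coordinate, hence lies in the ball
    around any of its points. That ball has the same mass as the one around [V]. *)
Lemma gram_ball_gt0 V (e : R) : 0 < e -> (0 < Gam (gram_ball V (1 - e)))%E.
Proof.
move=> e0; pose c : R := #|I|.+1%:R.
have c0 : 0 < c by rewrite ltr0n.
have [A [mA A0 HA]] := @small_oscillation Gam (Num.sqrt (e / c))
  ltac:(by rewrite sqrtr_gt0 divr_gt0).
have [x Ax] : A !=set0.
  by apply/set0P/eqP => A00; rewrite A00 measure0 ltxx in A0.
rewrite (ball_cst V x); apply: lt_le_trans A0 _.
apply: le_measure; rewrite ?inE//; first exact: measurable_gram_ball.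
move=> y Ay; rewrite /gram_ball /=.
suff : 2 - 2 * gram x y <= e by lra.
rewrite -sum_sqr_sub.
apply: (@le_trans _ _ (\sum_(i : I) e / c)).
  apply: ler_sum => i _; rewrite -real_normK ?num_real//.
  have -> : e / c = Num.sqrt (e / c) ^+ 2.
    by rewrite sqr_sqrtr// divr_ge0// ltW.
  by apply: lerXn2r; rewrite ?nnegrE ?sqrtr_ge0//; exact: HA.
rewrite sumr_const -[leLHS]mulr_natr mulrAC ler_pdivrMr//.
by rewrite ler_pM2l// ler_nat.
Qed.

End uniform_balls.

(** Markov's inequality for the kernel power. *)
Lemma moment_ge_ball m mu V (c : R) : 0 <= c ->
  ((c ^+ m)%:E * mu (gram_ball V c) <= (moment m mu V)%:E)%E.
Proof.
move=> c0; rewrite EFin_moment -integral_cst; last exact: measurable_gram_ball.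
apply: (@le_trans _ _ (\int[mu]_(W in gram_ball V c) (gram V W ^+ m)%:E)%E).
  apply: ge0_le_integral => //.
  - exact: measurable_gram_ball.
  - by move=> W _ /=; rewrite lee_fin exprn_ge0.
  - apply/measurable_EFinP; apply: measurable_funTS.
    exact: measurable_gramX.
  - move=> W /ltW cW; rewrite lee_fin.
    by apply: lerXn2r => //; rewrite nnegrE.
apply: ge0_subset_integral => //.
- exact: measurable_gram_ball.
- by apply/measurable_EFinP; exact: measurable_gramX.
- by move=> W _; rewrite lee_fin gramX_ge0.
Qed.

Definition gram_open (U : set T) := forall V, U V ->
  exists2 e : R, 0 < e & gram_ball V (1 - e) `<=` U.

Lemma gram_openI : setI_closed gram_open.
Proof.
move=> A B oA oB V [/oA[e e0 eA] /oB[f f0 fB]].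
exists (Num.min e f); first by rewrite lt_min e0.
move=> W; rewrite /gram_ball /= => HW; split.
- by apply: eA; apply: le_lt_trans HW; rewrite lerB// ge_min lexx.
- by apply: fB; apply: le_lt_trans HW; rewrite lerB// ge_min lexx orbT.
Qed.

(** * Constant moments determine the measure *)

Section approximate_identity.
Variables (Gam : probability T R) (g : nat -> R).
Hypothesis ball_gt0 : forall V (e : R), 0 < e ->
  (0 < Gam (gram_ball V (1 - e)))%E.
Hypothesis momentGam : forall m V, moment m Gam V = g m.

Lemma moment_cst_gt0 m : 0 < g m.
Proof.
rewrite -(momentGam m point) -lte_fin.
have h : 0 <= 1 - 2^-1 :> R by lra.
apply: lt_le_trans (moment_ge_ball m Gam point h).
by rewrite mule_gt0 ?ball_gt0 ?invr_gt0 ?ltr0n// lte_fin exprn_gt0//; lra.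
Qed.

(* Off a neighbourhood of [V] the kernel [gram V W ^+ m] is at most
   [(1 - e) ^+ m], while its total mass [g m] is at least
   [(1 - e / 2) ^+ m] times the mass of a smaller ball. *)
Lemma open_mass_cvg nu U V : (forall m V, moment m nu V = g m) ->
  measurable U -> gram_open U -> U V ->
  (\int[nu]_(W in U) (gram V W ^+ m) / g m) @[m --> \oo] --> (1 : R).
Proof.
move=> momentnu mU oU UV; have [e' e'0 e'U] := oU _ UV.
(* Capping at 1 keeps [1 - e] nonnegative, so that its powers bound those of the kernel outside
   [U]. *)
pose e := Num.min e' 1.
have e0 : 0 < e by rewrite lt_min e'0 ltr01.
have e1 : e <= 1 by rewrite ge_min lexx orbT.
have eU : gram_ball V (1 - e) `<=` U.
  move=> W HW; apply: e'U; apply: le_lt_trans HW.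
  by rewrite lerB// ge_min lexx.
pose p := fine (Gam (gram_ball V (1 - e / 2))).
have mB := measurable_gram_ball V (1 - e / 2).
have pfin : Gam (gram_ball V (1 - e / 2)) \is a fin_num by exact: fin_num_measure.
have p0 : 0 < p by rewrite fine_gt0// ball_gt0 ?divr_gt0//= ltey_eq pfin.
(* Ratio of the kernel bound outside [U] to the one on the smaller ball. The share of [g m] lost
   outside [U] is at most [q ^+ m / p]. *)
pose q := (1 - e) / (1 - e / 2).
have q0 : 0 <= q by apply: divr_ge0; lra.
have q1 : q < 1 by rewrite ltr_pdivrMr; lra.
have gp m : (1 - e / 2) ^+ m * p <= g m.
  rewrite -(momentGam m V) -lee_fin EFinM fineK//.
  by apply: moment_ge_ball; lra.
have lo m : 1 - q ^+ m / p <= \int[nu]_(W in U) (gram V W ^+ m) / g m.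
  have split : g m = \int[nu]_(W in U) (gram V W ^+ m) +
      \int[nu]_(W in ~` U) (gram V W ^+ m).
    rewrite -(momentnu m V) /moment -(setUv U) Rintegral_setU//.
    - exact: measurableC.
    - by rewrite setUv; exact: integrable_gramX.
    - by apply/disj_set2P; rewrite setICr.
  have out : \int[nu]_(W in ~` U) (gram V W ^+ m) <= (1 - e) ^+ m.
    have mUC : measurable (~` U) by exact: measurableC.
    apply: (@le_trans _ _ (\int[nu]_(W in ~` U) ((1 - e) ^+ m))).
      apply: le_Rintegral => //; first exact: integrable_gramX.
        by apply: (@probability_integrable _ _ _ _ _ _ `|(1 - e) ^+ m|).
      move=> W UW; apply: lerXn2r; rewrite ?nnegrE ?gram_ge0//; first lra.
      by rewrite leNgt; apply/negP => /eU.
    rewrite Rintegral_cst// ler_piMr ?exprn_ge0//; first lra.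
    rewrite -lee_fin fineK ?fin_num_measure//.
    exact: probability_le1.
  rewrite ler_pdivlMr ?moment_cst_gt0// mulrBl mul1r.
  rewrite [X in X - _]split lerBlDr lerD2l; apply: le_trans out _.
  have y0 : 0 < (1 - e / 2) ^+ m by rewrite exprn_gt0//; lra.
  rewrite /q expr_div_n -!mulrA ler_peMr ?exprn_ge0//; first lra.
  by rewrite mulrA -invfM mulrC ler_pdivlMr ?mulr_gt0// mul1r.
have hi m : \int[nu]_(W in U) (gram V W ^+ m) / g m <= 1.
  rewrite ler_pdivrMr ?moment_cst_gt0// mul1r -(momentnu m V).
  exact: Rintegral_gramX_le.
apply: (@squeeze_cvgr _ _ _ _ (fun m => 1 - q ^+ m / p) (cst 1)).
- by near=> m; rewrite lo hi.
- rewrite -[X in _ --> X]subr0 -[X in _ - X](mul0r p^-1).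
  apply: cvgB; first exact: cvg_cst.
  by apply: cvgMl; apply: cvg_expr; rewrite ger0_norm.
- exact: cvg_cst.
Unshelve. all: by end_near. Qed.

(** The normalised kernel masses of [U] under [nu] tend to 1 on [U]. Fatou for [mu] bounds [mu U] by
    their integrals over [U]; after exchanging the integrals, the inner one is at most the full
    moment [g m] of [mu], which leaves [nu U]. The hypotheses are symmetric, so equality follows on
    open sets. *)
Lemma open_measure_le mu nu U : (forall m V, moment m mu V = g m) ->
  (forall m V, moment m nu V = g m) ->
  measurable U -> gram_open U -> (mu U <= nu U)%E.
Proof.
move=> momentmu momentnu mU oU.
pose f m V := ((\int[nu]_(W in U) (gram V W ^+ m)) / g m)%:E.
have f0 m V : U V -> (0 <= f m V)%E.
  move=> _; rewrite lee_fin; apply: divr_ge0.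
    by apply: Rintegral_ge0 => W _; exact: gramX_ge0.
  exact/ltW/moment_cst_gt0.
have mf m : measurable_fun U (f m).
  apply/measurable_EFinP; apply: measurable_funTS.
  by apply: measurable_funM => //; exact: measurable_Rintegral_gramX.
have -> : mu U = (\int[mu]_(V in U) limn_einf (f^~ V))%E.
  rewrite -[LHS]mul1e -integral_cst//; apply: eq_integral => V /set_mem UV.
  suff /cvg_limn_einf_sup[-> _] : f m V @[m --> \oo] --> 1%E by [].
  by apply/cvg_EFin; [near=> m|exact: open_mass_cvg].
apply: (le_trans (fatou mu mU mf f0)).
rewrite limn_einf_lim; apply: lime_le; first exact: is_cvg_einfs.
near=> m; apply: (@le_trans _ _ (\int[mu]_(V in U) f m V)%E).
  apply: ereal_inf_lbound; exists m => //=; exact: leqnn.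
have fE : (\int[mu]_(V in U) f m V)%E =
    (\int[mu]_(V in U) (\int[nu]_(W in U) (gram V W ^+ m) / g m))%:E.
  rewrite /Rintegral fineK//; apply: integrable_fin_num => //.
  apply: (@probability_integrable _ _ _ _ _ _ (g m)^-1) => //.
    by apply: measurable_funM => //; exact: measurable_Rintegral_gramX.
  move=> V; rewrite normrM normfV (gtr0_norm (moment_cst_gt0 m)).
  apply: ler_piMl; first by rewrite invr_ge0 ltW// moment_cst_gt0.
  rewrite ger0_norm.
    exact: le_trans (Rintegral_gramX_le m nu V mU) (moment_le1 m nu V).
  by apply: Rintegral_ge0 => W _; exact: gramX_ge0.
rewrite fE RintegralZr//; last exact: integrable_Rintegral_gramX.
rewrite Rintegral_gramX_exchange//.
rewrite -[leRHS]fineK ?fin_num_measure// lee_fin.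
rewrite ler_pdivrMr ?moment_cst_gt0// mulrC -Rintegral_cst//.
apply: le_Rintegral => //; first exact: integrable_Rintegral_gramX.
  by apply: (@probability_integrable _ _ _ _ _ _ `|g m|).
by move=> W _; rewrite -(momentmu m W); exact: Rintegral_gramX_le.
Unshelve. all: by end_near. Qed.

Lemma moment_determines mu nu : measurable = <<s gram_open>> ->
  (forall m V, moment m mu V = g m) -> (forall m V, moment m nu V = g m) ->
  forall A, measurable A -> mu A = nu A.
Proof.
move=> mE momentmu momentnu A mA.
apply: (measure_unique gram_open (fun=> setT)) => //.
- exact: gram_openI.
- by move=> _ V _; exists 1.
- by rewrite bigcup_const//; exists 0%N.
- move=> U oU; have mU : measurable U by rewrite mE; exact: sub_sigma_algebra.
  by apply/eqP; rewrite eq_le !open_measure_le.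
- by move=> _; apply: le_lt_trans (probability_le1 mu measurableT) _; rewrite ltry.
Qed.

End approximate_identity.

Lemma moment0 mu V : moment 0 mu V = 1.
Proof.
rewrite -[RHS](Rintegral_probability_cst mu).
by apply: eq_Rintegral => W _; rewrite expr0.
Qed.

Lemma ler_sub_exp (x y : R) m : 0 <= x <= 1 -> 0 <= y <= 1 ->
  `|x ^+ m - y ^+ m| <= m%:R * `|x - y|.
Proof.
move=> /andP[x0 x1] /andP[y0 y1].
rewrite subrXX normrM mulrC ler_wpM2r//.
apply: le_trans (ler_norm_sum _ _ _) _.
apply: (@le_trans _ _ (\sum_(i < m) 1)); last by rewrite sumr_const card_ord.
apply: ler_sum => i _; rewrite normrM !normrX !ger0_norm//.
by rewrite mulr_ile1 ?exprn_ge0 ?exprn_ile1.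
Qed.

(** Makes the lower semicontinuity of potentials quantitative. The radius [e ^+ 2 / 2] says that the
    unit vectors of [V] and [V'] are at distance less than [e], so each coordinate moves by at most
    [e]. *)
Lemma moment_near m mu V V' (e : R) : 0 <= e ->
  gram_ball V (1 - e ^+ 2 / 2) V' ->
  moment m mu V <= moment m mu V' + m%:R * (#|I|%:R * e).
Proof.
move=> e0 VV'; have phie i : `|phi i V - phi i V'| <= e.
  rewrite -(@ler_pXn2r _ 2) ?nnegrE// real_normK ?num_real//.
  apply: (@le_trans _ _ (2 - 2 * gram V V')).
    rewrite -sum_sqr_sub (bigD1 i)//= lerDl sumr_ge0// => j _.
    exact: sqr_ge0.
  by move: VV'; rewrite /gram_ball /=; lra.
have grame W : `|gram V W - gram V' W| <= #|I|%:R * e.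
  rewrite /gram -sumrB; apply: le_trans (ler_norm_sum _ _ _) _.
  apply: (@le_trans _ _ (\sum_(i : I) e)); last by rewrite sumr_const mulr_natl.
  apply: ler_sum => i _; rewrite -mulrBl normrM.
  by apply: le_trans (phie i); rewrite ler_piMr// phi_le1.
set c := _ * _.
have intc : mu.-integrable setT (EFin \o fun=> c).
  by apply: (@probability_integrable _ _ _ _ _ _ `|c|).
have intm V1 := @integrable_gramX mu setT m V1 measurableT.
rewrite -[X in _ + X](Rintegral_probability_cst mu) /moment -RintegralD//.
apply: le_Rintegral => //.
  exact: (integrableD measurableT (intm V') intc).
move=> W _; rewrite -lerBlDl; apply: le_trans (ler_norm _) _.
apply: le_trans (@ler_sub_exp _ _ m _ _) _; rewrite ?gram_ge0 ?gram_le1//.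
by rewrite ler_wpM2l.
Qed.

(** * Potentials of power series in the kernel *)

Section potential.
Variable a : nat -> R.
Hypothesis a_ge0 : forall m, 0 <= a m.
Hypothesis a_gt0 : forall m, 0 < a m.+1.
Local Open Scope ereal_scope.

Definition potential mu V : \bar R := \sum_(m <oo) (a m * moment m mu V)%:E.

Lemma potential_term_ge0 m mu V : 0 <= (a m * moment m mu V)%:E.
Proof. by rewrite lee_fin mulr_ge0// moment_ge0. Qed.

Lemma measurable_potential_term m mu :
  measurable_fun setT (fun V => (a m * moment m mu V)%:E).
Proof.
apply/measurable_EFinP; apply: measurable_funM => //.
exact: measurable_moment.
Qed.

Lemma measurable_potential mu : measurable_fun setT (potential mu).
Proof.
apply: ge0_emeasurable_sum => m; last by move=> _; exact: measurable_potential_term.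
by move=> V _ _; exact: potential_term_ge0.
Qed.

Lemma potential_ge0 mu V : 0 <= potential mu V.
Proof. by apply: nneseries_ge0 => m _ _; exact: potential_term_ge0. Qed.

Lemma integral_gram_series mu V :
  \int[mu]_W (\sum_(m <oo) (a m * gram V W ^+ m)%:E) = potential mu V.
Proof.
rewrite integral_nneseries//.
- apply: eq_eseriesr => m _; rewrite EFinM EFin_moment -ge0_integralZl_EFin//.
  + by move=> W _; rewrite lee_fin gramX_ge0.
  + by apply/measurable_EFinP; exact: measurable_gramX.
- move=> m; apply/measurable_EFinP; apply: measurable_funM => //.
  exact: measurable_gramX.
- by move=> m W _; rewrite lee_fin mulr_ge0// gramX_ge0.
Qed.

Lemma integral_potential mu nu : \int[nu]_V potential mu V =
  \sum_(m <oo) (a m * \int[nu]_V moment m mu V)%R%:E.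
Proof.
rewrite integral_nneseries//.
- apply: eq_eseriesr => m _.
  under eq_integral do rewrite EFinM.
  rewrite ge0_integralZl_EFin//.
  + rewrite EFinM [in RHS]/Rintegral fineK//.
    apply: integrable_fin_num => //.
    exact: (@integrable_Rintegral_gramX _ _ _ setT setT).
  + by move=> V _; rewrite lee_fin moment_ge0.
  + by apply/measurable_EFinP; exact: measurable_moment.
- by move=> m; exact: measurable_potential_term.
- by move=> m V _; exact: potential_term_ge0.
Qed.

Variables (Gam : probability T R) (g : nat -> R).
Hypothesis ball_gt0 : forall V (e : R), (0 < e)%R ->
  0 < Gam (gram_ball V (1 - e)).
Hypothesis momentGam : forall m V, moment m Gam V = g m.

Definition min_energy : \bar R := \sum_(m <oo) (a m * g m)%:E.

Lemma potential_invariant V : potential Gam V = min_energy.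
Proof. by apply: eq_eseriesr => m _; rewrite momentGam. Qed.

Lemma integral_potential_invariant mu :
  \int[Gam]_V potential mu V = min_energy.
Proof.
rewrite integral_potential; apply: eq_eseriesr => m _.
by rewrite (Rintegral_moment_cst (momentGam m)).
Qed.

(** A lower bound of the potential is at most its average against [Gam], which is the same for every
    [mu]. *)
Lemma potential_le_min_energy mu (b : \bar R) : 0 <= b ->
  (forall V, b <= potential mu V) -> b <= min_energy.
Proof.
move=> b0 bp; rewrite -(integral_potential_invariant mu).
rewrite -[b]mule1 -(probability_setT Gam) -integral_cst//.
by apply: ge0_le_integral => //; exact: measurable_potential.
Qed.

Lemma potential_constant mu : min_energy < +oo ->
  (forall V, min_energy <= potential mu V) ->
  forall V, potential mu V = min_energy.
Proof.
move=> Efin Ep V; apply/eqP; rewrite eq_le Ep andbT leNgt; apply/negP => EV.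
have E0 : 0 <= min_energy.
  by rewrite -(potential_invariant V) potential_ge0.
have EE : min_energy = (fine min_energy)%:E by rewrite fineK// ge0_fin_numE.
(* If the potential exceeded the minimum at [V], a partial sum would already do so. Partial sums are
   continuous, so half of the excess [h] survives on a ball [B] of positive mass, and the average
   against [Gam] becomes too large. *)
pose S n W : R := (\sum_(0 <= m < n) a m * moment m mu W)%R.
have Sle n W : (S n W)%:E <= potential mu W.
  rewrite /S -sumEFin; apply: nneseries_lim_ge => m _ _.
  exact: potential_term_ge0.
have [n nS] : exists n, (fine min_energy < S n V)%R.
  apply: contrapT => noS; move: EV; apply/negP; rewrite -leNgt.
  apply: lime_le; first by apply: is_cvg_nneseries => m _ _; exact: potential_term_ge0.
  near=> n; rewrite sumEFin EE lee_fin leNgt; apply/negP => nS.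
  by apply: noS; exists n.
pose h : R := ((S n V - fine min_energy) / 2)%R.
have h0 : (0 < h)%R by rewrite divr_gt0// subr_gt0.
have hge0 : (0 <= h)%R by exact: ltW.
(* A Lipschitz constant of the partial sum, by [moment_near]; the added 1 makes it positive. *)
pose C : R := (\sum_(0 <= m < n) a m * (m%:R * #|I|%:R) + 1)%R.
have C0 : (0 < C)%R.
  rewrite ltr_wpDl// sumr_ge0// => m _.
  by rewrite mulr_ge0 ?mulr_ge0.
pose e : R := (h / C)%R.
have e0 : (0 < e)%R by rewrite divr_gt0.
pose B := gram_ball V (1 - e ^+ 2 / 2).
have mB : measurable B by exact: measurable_gram_ball.
have BS W : B W -> (fine min_energy + h <= S n W)%R.
  move=> BW.
  have -> : (fine min_energy + h = S n V - C * e)%R.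
    by rewrite /e mulrCA divff ?gt_eqF// mulr1 /h; field.
  rewrite lerBlDr; apply: (@le_trans _ _
    (S n W + \sum_(0 <= m < n) a m * (m%:R * #|I|%:R) * e)%R).
    rewrite /S -big_split /=; apply: ler_sum => m _.
    rewrite -[X in (_ <= _ + X)%R]mulrA -mulrDr ler_wpM2l// -mulrA.
    exact: moment_near (ltW e0) BW.
  rewrite lerD2l -mulr_suml; apply: ler_wpM2r; first exact: ltW.
  by rewrite /C lerDl.
have : (fine min_energy)%:E + h%:E * Gam B <= min_energy.
  rewrite -[leRHS](integral_potential_invariant mu).
  apply: (@le_trans _ _
      (\int[Gam]_W ((fine min_energy)%:E + h%:E * (\1_B W)%:E))).
    rewrite ge0_integralD//=.
    - rewrite ge0_integralZl_EFin//=.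
        rewrite integral_indic// setIT integral_cst//.
        by rewrite [X in _ <= _ * X + _]probability_setT mule1.
      exact/measurable_EFinP.
    - by move=> W _; rewrite -EE.
    - by move=> W _; rewrite mule_ge0// lee_fin.
    - by apply/measurable_EFinP; apply: measurable_funM.
  apply: ge0_le_integral => //.
  - move=> W _; by rewrite -EE adde_ge0// mule_ge0// lee_fin.
  - apply: emeasurable_funD => //; apply/measurable_EFinP.
    exact: measurable_funM.
  - exact: measurable_potential.
  - move=> W _; rewrite indicE; case: (boolP (W \in B)) => [/set_mem BW|_] /=.
      by rewrite mule1; apply: le_trans (Sle n W); rewrite lee_fin BS.
    by rewrite mule0 adde0 -EE.
apply/negP; rewrite -ltNge {1}EE lteDl.
  by rewrite mule_gt0// ball_gt0// divr_gt0// exprn_gt0.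
done.
Unshelve. all: by end_near. Qed.

Lemma potential_unique mu : min_energy < +oo ->
  (forall V, min_energy <= potential mu V) ->
  forall m V, moment m mu V = g m.
Proof.
move=> Efin Ep; have pE := potential_constant Efin Ep.
have energy : min_energy = \sum_(m <oo) (a m * \int[mu]_V moment m mu V)%R%:E.
  rewrite -integral_potential; under eq_integral do rewrite pE.
  by rewrite integral_cst// [X in _ * X]probability_setT mule1.
(* The excesses are nonnegative and, the minimum being finite, sum to zero; each one therefore
   vanishes. *)
pose b m := (a m * (\int[mu]_V moment m mu V - g m))%R.
have b0 m : (0 <= b m)%R.
  by rewrite mulr_ge0// subr_ge0 (energy_ge (momentGam m)).
have g0 m : (0 <= g m)%R by rewrite -(momentGam m point) moment_ge0.
have sumb : \sum_(m <oo) (b m)%:E = 0.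
  have : min_energy = min_energy + \sum_(m <oo) (b m)%:E.
    rewrite {1}energy -nneseriesD//.
    + by apply: eq_eseriesr => m _; rewrite -EFinD /b mulrBr addrC subrK.
    + by move=> m _ _; rewrite lee_fin mulr_ge0.
    + by move=> m _ _; rewrite lee_fin.
  have sb0 : 0 <= \sum_(m <oo) (b m)%:E.
    by apply: nneseries_ge0 => m _ _; rewrite lee_fin.
  move=> EEb. apply/le_anti; rewrite sb0 andbT leNgt; apply/negP => s0.
  suff : min_energy < min_energy by rewrite ltxx.
  rewrite {2}EEb lteDl// ge0_fin_numE//; apply: nneseries_ge0 => m _ _.
  by rewrite lee_fin mulr_ge0.
(* The coefficient [a 0] may vanish, but moments of order 0 are always 1. *)
case=> [V|m]; first by rewrite -(momentGam 0 V) !moment0.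
apply: (energy_eq (momentGam m.+1)).
have bm0 : (b m.+1)%:E <= 0.
  rewrite -sumb; apply: le_trans (nneseries_lim_ge m.+2 _); last first.
    by move=> k _ _; rewrite lee_fin.
  by rewrite sumEFin lee_fin big_nat_recr//= lerDr sumr_ge0.
apply/eqP; rewrite -subr_eq0 -(mulrI_eq0 _ (mulfI (lt0r_neq0 (a_gt0 m)))).
by apply/eqP/le_anti; rewrite b0 andbT -lee_fin.
Qed.

End potential.
End gram.

(** * Lines and the action of the unitary group *)

Section adjoint.
Variable R : realType.
Local Notation C := R[i].
Implicit Types z : C.

Lemma adj_conjc m p (A : 'M[C]_(m, p)) : adj A = map_mx conjc (A^T).
Proof. by apply/matrixP => i j; rewrite !mxE; case: (A j i). Qed.

Lemma adj_mul m p q (A : 'M[C]_(m, p)) (B : 'M[C]_(p, q)) :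
  adj (A *m B) = adj B *m adj A.
Proof. by rewrite !adj_conjc trmx_mul map_mxM. Qed.

Lemma adj_adj m p (A : 'M[C]_(m, p)) : adj (adj A) = A.
Proof. by apply/matrixP => i j; rewrite !adj_conjc !mxE conjcK. Qed.

Lemma adj_sub m p (A B : 'M[C]_(m, p)) : adj (A - B) = adj A - adj B.
Proof. by apply/matrixP => i j; rewrite !adj_conjc !mxE rmorphB. Qed.

Lemma adj_scale m p c (A : 'M[C]_(m, p)) : adj (c *: A) = conjc c *: adj A.
Proof. by apply/matrixP => i j; rewrite !adj_conjc !mxE rmorphM. Qed.

Lemma adj_id m : adj (1%:M : 'M[C]_m) = 1%:M.
Proof. by apply/matrixP => i j; rewrite !adj_conjc !mxE conjc_nat eq_sym. Qed.

Lemma normsq_ge0 m (v : 'cV[C]_m) : 0 <= normsq v.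
Proof. by apply: sumr_ge0 => i _; rewrite addr_ge0 ?sqr_ge0. Qed.

Lemma normsq_eq0 m (v : 'cV[C]_m) : normsq v = 0 -> v = 0.
Proof.
move=> v0; apply/colP => i; rewrite mxE.
have : complex.Re (v i ord0) ^+ 2 + complex.Im (v i ord0) ^+ 2 == 0.
  move/eqP: v0; rewrite psumr_eq0 => [/allP/(_ i (mem_index_enum i))//|k _].
  by rewrite addr_ge0 ?sqr_ge0.
rewrite paddr_eq0 ?sqr_ge0// !sqrf_eq0; case: (v i ord0) => a b /=.
by move=> /andP[/eqP -> /eqP ->].
Qed.

Lemma adj_normsq m (v : 'cV[C]_m) : adj v *m v = (normsq v)%:C%C%:M.
Proof.
rewrite [LHS]mx11_scalar; congr (_%:M).
rewrite mxE /normsq rmorph_sum; apply: eq_bigr => i _ /=.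
rewrite mxE; case: (v i ord0) => a b /=.
by apply/eqP; rewrite eq_complex /=; apply/andP; split; apply/eqP; ring.
Qed.

Lemma normsq_mul_unitary m (U : 'M[C]_m) (v : 'cV[C]_m) :
  adj U *m U = 1%:M -> normsq (U *m v) = normsq v.
Proof.
move=> UU; have := adj_normsq (U *m v).
rewrite adj_mul mulmxA -(mulmxA (adj v)) UU mulmx1 adj_normsq.
by move=> /matrixP/(_ ord0 ord0); rewrite !mxE /= !mulr1n => /complexI.
Qed.

Section field_closed.
Variable H : Hfield.

Lemma inH_mul z1 z2 : inH H z1 -> inH H z2 -> inH H (z1 * z2).
Proof.
rewrite /inH; case: H => //; case: z1 => a b; case: z2 => c e /=.
by move=> /eqP -> /eqP ->; rewrite mulr0 mul0r addr0.
Qed.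

Lemma inH_add z1 z2 : inH H z1 -> inH H z2 -> inH H (z1 + z2).
Proof.
rewrite /inH; case: H => //; case: z1 => a b; case: z2 => c e /=.
by move=> /eqP -> /eqP ->; rewrite addr0.
Qed.

Lemma inH_conj z : inH H (conjc z) = inH H z.
Proof. by rewrite /inH; case: H => //; case: z => a b /=; rewrite oppr_eq0. Qed.

Lemma inH_real (r : R) : inH H r%:C%C.
Proof. by rewrite /inH; case: H => /=. Qed.

Lemma inH_opp z : inH H z -> inH H (- z).
Proof.
by rewrite -mulN1r; apply: inH_mul; rewrite -(rmorphN1 (real_complex R)) inH_real.
Qed.

Lemma mxHP m p (A : 'M[C]_(m, p)) :
  reflect (forall i j, inH H (A i j)) (mxH H A).
Proof.
apply: (iffP forallP) => [HA i j|HA i]; first exact/(forallP (HA i)).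
by apply/forallP => j.
Qed.

Lemma mxH_mul m p q (A : 'M[C]_(m, p)) (B : 'M[C]_(p, q)) :
  mxH H A -> mxH H B -> mxH H (A *m B).
Proof.
move=> /mxHP HA /mxHP HB; apply/mxHP => i j; rewrite mxE.
apply: (big_ind (inH H)) => [||k _]; last exact: inH_mul.
- exact: (inH_real 0).
- exact: inH_add.
Qed.

Lemma mxH_adj m p (A : 'M[C]_(m, p)) : mxH H A -> mxH H (adj A).
Proof.
by move=> /mxHP HA; apply/mxHP => i j; rewrite adj_conjc !mxE inH_conj.
Qed.

Lemma mxH_sub m p (A B : 'M[C]_(m, p)) :
  mxH H A -> mxH H B -> mxH H (A - B).
Proof.
move=> /mxHP HA /mxHP HB; apply/mxHP => i j; rewrite !mxE.
exact/inH_add/inH_opp.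
Qed.

Lemma mxH_scale m p c (A : 'M[C]_(m, p)) :
  inH H c -> mxH H A -> mxH H (c *: A).
Proof.
by move=> Hc /mxHP HA; apply/mxHP => i j; rewrite !mxE; exact: inH_mul.
Qed.

Lemma mxH_1 m : mxH H (1%:M : 'M[C]_m).
Proof.
apply/mxHP => i j; rewrite mxE -(rmorph_nat (real_complex R)).
exact: inH_real.
Qed.

End field_closed.
End adjoint.

(** * Rank-one projections as unit vectors *)

Section lines.
Variables (R : realType) (H : Hfield) (n : nat).
Local Notation C := R[i].
Local Notation d := n.+2.
Implicit Types (x y : 'cV[C]_d) (V W : GrB R H n).

Lemma sphere_adj x : @sphere R H n x -> adj x *m x = 1%:M.
Proof. by move=> [_ x1]; rewrite adj_normsq x1. Qed.

Lemma is_line_proj_sphere x : @sphere R H n x -> is_line_proj H (x *m adj x).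
Proof.
move=> Sx; have xx := sphere_adj Sx; have Hx := Sx.1.
apply/and4P; split.
- by apply: mxH_mul => //; exact: mxH_adj.
- by rewrite mulmxA -(mulmxA x) xx mulmx1.
- by rewrite adj_mul adj_adj.
- rewrite eqn_leq (leq_trans (mxrankM_maxl _ _) (rank_leq_col _)) /=.
  rewrite lt0n mxrank_eq0; apply/eqP => x0.
  have := congr1 (fun A => adj x *m A *m x) x0.
  rewrite mulmx0 mul0mx mulmxA xx mul1mx xx.
  by move=> /matrixP/(_ ord0 ord0)/eqP; rewrite !mxE oner_eq0.
Qed.

Definition line x (Sx : @sphere R H n x) : GrB R H n :=
  exist (fun P => is_line_proj H P) _ (is_line_proj_sphere Sx).

(** The unit vector is a normalised nonzero column of the projection, which also has its entries in
    the right field. *)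
Lemma line_surj V : exists x (Sx : @sphere R H n x), V = line Sx.
Proof.
case: V => P PP; have /and4P[HP /eqP PPP /eqP aP /eqP rP] := PP.
have [a [b Pab]] : exists (a : 'cV[C]_d) (b : 'rV[C]_d), P = a *m b.
  move: (mulmx_base P); move: (col_base P) (row_base P); rewrite rP => a b <-.
  by exists a, b.
have [j Pj] : exists j, col j P != 0.
  apply: contrapT => P0; move: rP; suff -> : P = 0 by rewrite mxrank0.
  apply/matrixP => i j; have : col j P = 0.
    by apply/eqP/negPn/negP => Pj; apply: P0; exists j.
  by move=> /colP/(_ i); rewrite !mxE.
pose e : 'cV[C]_d := delta_mx j ord0.
have vE : col j P = P *m e by rewrite colE.
pose v := P *m e; pose p := normsq v.
have p0 : 0 < p.
  rewrite lt_neqAle normsq_ge0 andbT eq_sym; apply: contra Pj => /eqP/normsq_eq0.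
  by rewrite vE => /eqP.
have vv : adj v *m v = p%:C%C%:M by exact: adj_normsq.
(* With [P = a b] of rank one, the product [P e e^* P] is a multiple of [P], and [e^* P e = p]
   identifies the factor. *)
have vvP : v *m adj v = p%:C%C *: P.
  have ePe : adj e *m P *m e = p%:C%C%:M.
    by rewrite -vv /v adj_mul aP -[in LHS]PPP !mulmxA.
  pose s := (b *m e) ord0 ord0; pose t := (adj e *m a) ord0 ord0.
  have sE : b *m e = s%:M by exact: mx11_scalar.
  have tE : adj e *m a = t%:M by exact: mx11_scalar.
  have -> : p%:C%C = t * s.
    move: ePe; rewrite Pab mulmxA tE -mulmxA sE -scalar_mxM.
    by move=> /matrixP/(_ ord0 ord0); rewrite !mxE /= !mulr1n.
  rewrite /v adj_mul aP Pab !mulmxA -(mulmxA a b) sE -(mulmxA _ (adj e)) tE.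
  by rewrite !mul_mx_scalar -!scalemxAl scalerA.
pose r := Num.sqrt p.
have r0 : r != 0 by rewrite gt_eqF// sqrtr_gt0.
have rr : r * r = p by rewrite -expr2 sqr_sqrtr// ltW.
pose x := (r^-1)%:C%C *: v.
have xx : normsq x = 1.
  apply: (@complexI R); have := adj_normsq x.
  rewrite /x adj_scale -scalemxAl -scalemxAr vv conjc_real scalerA -rmorphM /=.
  rewrite -mul_scalar_mx -scalar_mxM -rmorphM /= -rr.
  move=> /matrixP/(_ ord0 ord0); rewrite !mxE /= !mulr1n => <-.
  by congr (_%:C)%C; field.
have Sx : @sphere R H n x.
  split=> //; apply: mxH_scale; first exact: inH_real.
  apply: mxH_mul => //; apply/mxHP => i k; rewrite mxE -(rmorph_nat (real_complex R)).
  exact: inH_real.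
exists x, Sx; apply/val_inj => /=.
rewrite /x adj_scale -scalemxAl -scalemxAr vvP conjc_real !scalerA -!rmorphM /=.
by rewrite -rr (_ : _ * _ = 1) ?scale1r//; field.
Qed.


Definition entry (c : 'I_d * 'I_d * bool) W : R :=
  let z := sval W c.1.1 c.1.2 in if c.2 then complex.Re z else complex.Im z.

Local Notation grm := (gram entry).

Lemma sum_entry (F : 'I_d * 'I_d * bool -> R) :
  \sum_c F c = \sum_i \sum_j (F (i, j, true) + F (i, j, false)).
Proof.
transitivity (\sum_(p : 'I_d * 'I_d) \sum_(b : bool) F (p, b)).
  by rewrite pair_bigA; apply: eq_bigr => -[].
rewrite [RHS]pair_bigA; apply: eq_bigr => -[i j] _ /=.
by rewrite big_bool.
Qed.

Lemma Re_sum (I : Type) (r : seq I) (F : I -> C) :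
  complex.Re (\sum_(i <- r) F i) = \sum_(i <- r) complex.Re (F i).
Proof. by apply: (big_morph (@complex.Re R)) => // -[a b] [c e]. Qed.

Lemma gram_line W x (Sx : @sphere R H n x) :
  grm W (line Sx) = normsq (sval W *m x).
Proof.
case: W => P PP; have /and4P[_ /eqP PPP /eqP aP _] := PP => /=.
have -> : normsq (P *m x) = complex.Re ((adj x *m P *m x) ord0 ord0).
  have := adj_normsq (P *m x); rewrite adj_mul aP !mulmxA -(mulmxA _ P P) PPP => ->.
  by rewrite mxE.
rewrite /gram sum_entry mxE Re_sum exchange_big; apply: eq_bigr => j _ /=.
rewrite mxE mulr_suml Re_sum; apply: eq_bigr => i _ /=.
rewrite /entry /= !mxE big_ord1 !mxE.
case: (x i ord0) (x j ord0) (P i j) => a b [c e] [p q] /=.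
ring.
Qed.

Lemma gramVV V : grm V V = 1.
Proof.
have [x [Sx ->]] := line_surj V; rewrite gram_line /=.
by rewrite -mulmxA (sphere_adj Sx) mulmx1 Sx.2.
Qed.

Lemma gram_ge0 V W : 0 <= grm V W.
Proof.
by have [x [Sx ->]] := line_surj W; rewrite gram_line normsq_ge0.
Qed.

Lemma frob_distE V W : frob_dist (sval V) (sval W) = Num.sqrt (2 - 2 * grm V W).
Proof.
rewrite -(sum_sqr_sub gramVV) sum_entry /frob_dist; congr (Num.sqrt _).
apply: eq_bigr => i _; apply: eq_bigr => j _; rewrite /entry /=.
by case: (sval V i j) (sval W i j) => a b [c e].
Qed.

Lemma frob_dist_lt V W (e : R) : 0 < e ->
  (frob_dist (sval V) (sval W) < e) = (1 - e ^+ 2 / 2 < grm V W).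
Proof.
move=> e0; rewrite frob_distE.
have -> : e = Num.sqrt (e ^+ 2) by rewrite sqrtr_sqr gtr0_norm.
rewrite ltr_sqrt ?exprn_gt0// sqr_sqrtr ?sqr_ge0//.
by apply/idP/idP => h; lra.
Qed.

Lemma Gr_openE : @Gr_open R H n = gram_open entry.
Proof.
apply/funext => A; apply/propext; split=> oA V AV.
- have [e e0 eA] := oA _ AV; exists (e ^+ 2 / 2); first by rewrite divr_gt0// exprn_gt0.
  by move=> W; rewrite /gram_ball /= -frob_dist_lt//; exact: eA.
- have [e e0 eA] := oA _ AV; exists (Num.sqrt (e * 2)).
    by rewrite sqrtr_gt0 mulr_gt0.
  move=> W; rewrite frob_dist_lt ?sqrtr_gt0 ?mulr_gt0// sqr_sqrtr ?mulr_ge0 ?ltW//.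
  by rewrite mulfK//; exact: eA.
Qed.

Lemma measurable_GrB : (@measurable _ (GrB R H n)) = <<s gram_open entry>>.
Proof. by rewrite -Gr_openE. Qed.

(** A coordinate is 1-Lipschitz for the Frobenius distance, so its superlevel sets are open. *)
Lemma measurable_entry c : measurable_fun [set: GrB R H n] (entry c).
Proof.
apply: (measurability _ (RGenOInfty.measurableE R)) => _ [_ [a ->] <-].
rewrite setTI; apply: sub_sigma_algebra => V /=; rewrite in_itv /= andbT => aV.
exists (entry c V - a); first by rewrite subr_gt0.
move=> W VW; rewrite /= in_itv /= andbT.
suff : entry c V - entry c W < entry c V - a by rewrite ltrD2l ltrN2.
apply: le_lt_trans VW; apply: le_trans (ler_norm _) _.
rewrite frob_distE -(sum_sqr_sub gramVV) -sqrtr_sqr ler_sqrt ?sumr_ge0//.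
  by rewrite (bigD1 c)//= lerDl sumr_ge0// => k _; exact: sqr_ge0.
by move=> k _; exact: sqr_ge0.
Qed.


(** * The unitary action and its transitivity *)

Section action.
Variable U : 'M[C]_d.
Hypothesis hU : unitary_mx H U.

Lemma sphere_unitary x : @sphere R H n x -> @sphere R H n (U *m x).
Proof.
move=> [Hx x1]; split; first exact: mxH_mul hU.1 Hx.
by rewrite normsq_mul_unitary// hU.2.
Qed.

Lemma is_line_proj_act V : is_line_proj H (U *m sval V *m adj U).
Proof.
have [x [Sx ->]] := line_surj V => /=.
have := is_line_proj_sphere (sphere_unitary Sx).
by rewrite adj_mul !mulmxA.
Qed.

Definition act V : GrB R H n :=
  exist (fun P => is_line_proj H P) _ (is_line_proj_act V).

Lemma act_line x (Sx : @sphere R H n x) :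
  act (line Sx) = line (sphere_unitary Sx).
Proof. by apply/val_inj; rewrite /= adj_mul !mulmxA. Qed.

Lemma gram_act V W : grm (act V) (act W) = grm V W.
Proof.
have [x [Sx ->]] := line_surj W; rewrite act_line !gram_line /=.
by rewrite -!mulmxA (mulmxA (adj U)) hU.2 mul1mx normsq_mul_unitary// hU.2.
Qed.

Lemma measurable_act : measurable_fun setT act.
Proof.
apply: (@measurability _ _ _ (GrB R H n) setT act (@Gr_open R H n)) => //.
move=> _ [A oA <-].
have {}oA : gram_open entry A by rewrite -Gr_openE.
rewrite setTI; apply: sub_sigma_algebra.
suff : gram_open entry (act @^-1` A) by rewrite -Gr_openE.
move=> V AV; have [e e0 eA] := oA _ AV; exists e => // W VW.
by apply: eA; rewrite /gram_ball /= gram_act.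
Qed.

Variable Gam : probability (GrB R H n) R.
Hypothesis hGam : Gr_invariant Gam.

Lemma measure_act A : measurable A -> Gam (act @^-1` A) = Gam A.
Proof.
move=> mA; rewrite -(hGam hU mA); congr (Gam _); apply/seteqP; split=> W /=.
  by move=> AW; exists (act W).
move=> [V AV VE]; suff -> : act W = V by [].
exact/val_inj/esym/VE.
Qed.

Lemma ball_act V c :
  Gam (gram_ball entry (act V) c) = Gam (gram_ball entry V c).
Proof.
rewrite -[LHS]measure_act; last exact: (measurable_gram_ball measurable_entry).
by congr (Gam _); apply/seteqP; split=> W; rewrite /gram_ball /= gram_act.
Qed.

Lemma moment_act m V : moment entry m Gam (act V) = moment entry m Gam V.
Proof.
rewrite /moment /Rintegral; congr fine.
transitivity (\int[pushforward Gam act]_W (grm (act V) W ^+ m)%:E)%E.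
  apply: eq_measure_integral; first exact: measurable_act.
  by move=> mact A mA _; exact: (esym (measure_act mA)).
rewrite ge0_integral_pushforward//=.
- by apply: eq_integral => W _ /=; rewrite gram_act.
- exact: measurable_act.
- apply/measurable_EFinP; exact: (measurable_gramX measurable_entry).
- by move=> W _; rewrite lee_fin gramX_ge0//; exact: gram_ge0.
Qed.

End action.

(** The reflection along [x - y] exchanges [x] and [y] provided that their inner product is real,
    which is what the hypothesis on the conjugate says. *)
Lemma householder x y : @sphere R H n x -> @sphere R H n y ->
  conjc ((adj y *m x) ord0 ord0) = (adj y *m x) ord0 ord0 ->
  exists2 U, unitary_mx H U & U *m x = y.
Proof.
move=> Sx Sy; have xx := sphere_adj Sx; have yy := sphere_adj Sy.
set r := (_ *m _) ord0 ord0 => rr.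
have yx : adj y *m x = r%:M by exact: mx11_scalar.
have xy : adj x *m y = r%:M.
  rewrite -[LHS]adj_adj adj_mul adj_adj yx; apply/matrixP => i j.
  by rewrite adj_conjc !mxE !ord1 /= !mulr1n.
pose u := x - y; have [u0|u0] := eqVneq u 0.
  exists 1%:M; first by split; [exact: mxH_1|rewrite adj_id mul1mx].
  by rewrite mul1mx; apply/eqP; rewrite -subr_eq0 -/u u0.
pose s := (normsq u)%:C%C.
have uu : adj u *m u = s%:M by exact: adj_normsq.
have s0 : s != 0.
  by apply: contra u0 => /eqP su; rewrite (@normsq_eq0 _ _ u)//; exact: complexI.
(* This gives [U x = x - (2 / s) (1 - r) u = x - u = y]. *)
have sE : s = 2 * (1 - r).
  move: uu; rewrite /u adj_sub mulmxBl !mulmxBr xx yy yx xy.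
  by move=> /matrixP/(_ ord0 ord0); rewrite !mxE /= !mulr1n => <-; ring.
have ux : adj u *m x = (1 - r)%:M.
  by rewrite /u adj_sub mulmxBl xx yx -raddfB.
pose c : C := 2 / s.
have cc : conjc c = c.
  by rewrite /c /s fmorph_div rmorph_nat /= oppr0.
pose U := 1%:M - c *: (u *m adj u).
have aU : adj U = U by rewrite /U adj_sub adj_id adj_scale cc adj_mul adj_adj.
have Ux : U *m x = y.
  rewrite /U mulmxBl mul1mx -scalemxAl -mulmxA ux mul_mx_scalar scalerA.
  rewrite (_ : c * _ = 1); first by rewrite scale1r /u opprB addrC subrK.
  by rewrite /c mulrAC -sE divff.
exists U => //; split.
  apply: mxH_sub; first exact: mxH_1.
  have Hu : mxH H u by apply: mxH_sub; [exact: Sx.1|exact: Sy.1].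
  apply: mxH_scale; last by apply: mxH_mul => //; exact: mxH_adj.
  rewrite /c /s -(rmorph_nat (real_complex R)) -fmorph_div.
  exact: inH_real.
pose E := u *m adj u.
have EE : E *m E = s *: E.
  by rewrite /E mulmxA -(mulmxA u) uu mul_mx_scalar -scalemxAl.
rewrite aU /U -/E mulmxBl mul1mx mulmxBr mulmx1 -scalemxAl -scalemxAr EE.
rewrite !scalerA -mulrA (_ : c * s = 2); last by rewrite /c divfK.
by rewrite mulr_natr mulr2n scalerDl opprB addrK subrK.
Qed.

Lemma act_transitive V W : exists U (hU : unitary_mx H U), act hU V = W.
Proof.
have [x [Sx ->]] := line_surj V; have [y [Sy ->]] := line_surj W.
pose z := (adj y *m x) ord0 ord0.
pose m : R := Num.sqrt (complex.Re z ^+ 2 + complex.Im z ^+ 2).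
(* The phase of the inner product: replacing [y] by [c y] keeps the line and makes the inner product
   with [x] real, as [householder] requires. *)
pose c : C := if z == 0 then 1 else z / m%:C%C.
have zz : z * conjc z = m%:C%C ^+ 2.
  rewrite -rmorphXn /= sqr_sqrtr ?addr_ge0 ?sqr_ge0//; case: (z) => p q /=.
  by apply/eqP; rewrite eq_complex /=; apply/andP; split; apply/eqP; ring.
have m0 : z != 0 -> m%:C%C != 0.
  apply: contra => /eqP m0.
  by move/eqP: zz; rewrite m0 expr0n /= mulf_eq0 conjc_eq0 orbb.
have cE : conjc c = if z == 0 then 1 else conjc z / m%:C%C.
  rewrite /c; case: ifP => _; first exact: conjc1.
  by rewrite fmorph_div /= oppr0.
have cc : c * conjc c = 1.
  rewrite cE /c; case: eqVneq => [_|/m0 z0]; first by rewrite mulr1.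
  by rewrite mulrACA zz -invfM -expr2 divff// expf_neq0.
have Hz : inH H z.
  by have /mxHP := mxH_mul (mxH_adj Sy.1) Sx.1; exact.
have Hc : inH H c.
  rewrite /c; case: ifP => _; first exact: (inH_real H 1).
  by apply: inH_mul => //; rewrite -fmorphV; exact: inH_real.
have zc : conjc (conjc c * z) = conjc c * z.
  have -> : conjc (conjc c * z) = conjc (conjc c) * conjc z by exact: rmorphM.
  rewrite conjcK cE /c; case: eqVneq => [z0|_].
    by rewrite z0 conjc0.
  by rewrite mulrAC [RHS]mulrAC [z * _]mulrC.
have Scy : @sphere R H n (c *: y).
  split; first exact: mxH_scale Hc Sy.1.
  apply: (@complexI R); have := adj_normsq (c *: y).
  rewrite adj_scale -scalemxAl -scalemxAr (sphere_adj Sy) scalerA mulrC cc scale1r.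
  by move=> /matrixP/(_ ord0 ord0); rewrite !mxE /= !mulr1n => <-.
have [] := @householder x (c *: y) Sx Scy.
  by rewrite adj_scale -scalemxAl mxE.
move=> U hU Ux; exists U, hU; apply/val_inj => /=.
rewrite mulmxA -mulmxA -adj_mul Ux adj_scale -scalemxAl -scalemxAr scalerA.
by rewrite cc scale1r.
Qed.

Section invariant.
Variable Gam : probability (GrB R H n) R.
Hypothesis hGam : Gr_invariant Gam.

Lemma invariant_ball V V' c :
  Gam (gram_ball entry V c) = Gam (gram_ball entry V' c).
Proof.
by have [U [hU <-]] := act_transitive V V'; rewrite ball_act.
Qed.

Lemma invariant_moment m V V' : moment entry m Gam V = moment entry m Gam V'.
Proof.
by have [U [hU <-]] := act_transitive V V'; rewrite moment_act.
Qed.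

End invariant.

End lines.

(** * Power series of the two kernels *)

Section power_series.
Variable R : realType.
Implicit Types (b a : nat -> R) (x t s : R).

Definition psum b N x : R := \sum_(m < N) b m * x ^+ m.
Definition dpsum b N x : R := \sum_(m < N) b m * (m%:R * x ^+ m.-1).

Lemma is_derive_psum b N x : is_derive x 1 (psum b N) (dpsum b N x).
Proof.
elim: N => [|N IH].
  rewrite (_ : psum b 0 = cst 0); last by apply/funext => y; rewrite /psum big_ord0.
  by rewrite /dpsum big_ord0; exact: is_derive_cst.
rewrite (_ : psum b N.+1 = psum b N + b N \*: (@id R) ^+ N); last first.
  apply/funext => y; rewrite /psum big_ord_recr /= fctE; congr (_ + _ * _).
  by rewrite exprfctE.
rewrite /dpsum big_ord_recr /=.
apply: is_deriveD; apply: is_derive_eq.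
by rewrite /GRing.scale /= mulr1 mulr_natl.
Qed.

(** Turns a bound on the derivative of a Taylor remainder into one on the remainder itself; the
    length [t] of the interval is absorbed by [t <= 1]. *)
Lemma mean_value_bound (F dF : R -> R) t (K : R) : 0 <= t <= 1 ->
  (forall x, 0 <= x <= t -> is_derive x 1 F (dF x)) ->
  (forall x, 0 <= x <= t -> 0 <= dF x <= K) ->
  0 <= F t - F 0 <= K.
Proof.
move=> /andP[t0 t1] FdF dFK.
have dF01 x : x \in `]0, t[%R -> is_derive x 1 F (dF x).
  by rewrite in_itv /= => /andP[x0 xt]; apply: FdF; rewrite !ltW.
have cF : {within `[0, t], continuous F}.
  apply: derivable_within_continuous => x x0t.
  have {}x0t : 0 <= x <= t by move: x0t; rewrite in_itv.
  by have [] := FdF x x0t.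
have [c] := MVT_segment t0 dF01 cF; rewrite in_itv /= subr0 => cin ->.
have /andP[c0 cK] := dFK _ cin.
rewrite mulr_ge0//=; apply: le_trans cK; exact: ler_piMr.
Qed.

Lemma cvg_geometric_bound (u : nat -> R) (l t K : R) : 0 <= t < 1 ->
  (forall N, 0 <= l - u N <= K * t ^+ N) -> u @ \oo --> l.
Proof.
move=> /andP[t0 t1] ul.
apply: (@squeeze_cvgr _ _ _ _ (fun N => l - K * t ^+ N) (cst l)).
- near=> N; have /andP[h1 h2] := ul N.
  by apply/andP; split; rewrite /=; lra.
- rewrite -[X in _ --> X]subr0 -[X in _ - X](mulr0 K).
  apply: cvgB; first exact: cvg_cst.
  by apply: cvgMr; apply: cvg_expr; rewrite ger0_norm.
- exact: cvg_cst.
Unshelve. all: by end_near. Qed.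

Lemma eseries_psum a t (l : R) : (psum a N t) @[N --> \oo] --> l ->
  (\sum_(m <oo) (a m * t ^+ m)%:E = l%:E)%E.
Proof.
move=> al; apply/cvg_lim => //.
rewrite (_ : (fun n => _) = EFin \o (fun N => psum a N t)).
  by apply/cvg_EFin => //; near=> N.
by apply/funext => N; rewrite /= /psum -(big_mkord xpredT (fun m => a m * t ^+ m)) sumEFin.
Unshelve. all: by end_near. Qed.

(* Abel's theorem for nonnegative coefficients: the sum at [1] is the supremum
   of the sums on [0, 1[. *)
Lemma eseries_at_one a (f : R -> R) (l : \bar R) : (forall m, 0 <= a m) ->
  (forall t, 0 <= t < 1 -> (\sum_(m <oo) (a m * t ^+ m)%:E = (f t)%:E)%E) ->
  (forall t, 0 <= t < 1 -> ((f t)%:E <= l)%E) ->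
  (forall r : R, (r%:E < l)%E -> exists2 t, 0 <= t < 1 & r < f t) ->
  (\sum_(m <oo) (a m)%:E = l)%E.
Proof.
move=> a0 af fl lf; apply/eqP; rewrite eq_le; apply/andP; split.
  apply: lime_le; first by apply: is_cvg_nneseries => m _ _; rewrite lee_fin.
  near=> N; rewrite sumEFin.
  case: l fl lf => [l fl _|_ _|fl _]; last 2 first.
  - by rewrite leey.
  - by have := fl 0; rewrite lexx ltr01 => /(_ isT).
  rewrite lee_fin; apply/ler_addgt0Pr => e e0.
  (* By Bernoulli's inequality [(1 - h) ^+ m >= 1 - h m], passing from 1 to [1 - h] costs the
     partial sum at most [h * K]. *)
  pose K := \sum_(0 <= m < N) a m * m%:R + 1.
  have K0 : 0 < K by rewrite ltr_wpDl// sumr_ge0// => m _; rewrite mulr_ge0.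
  pose h := Num.min 1 (e / K).
  have h0 : 0 < h by rewrite lt_min ltr01 divr_gt0.
  have h1 : h <= 1 by rewrite ge_min lexx.
  have hK : h * K <= e by rewrite -ler_pdivlMr// ge_min lexx orbT.
  have t01 : 0 <= 1 - h < 1 by apply/andP; split; lra.
  have := fl _ t01; rewrite lee_fin => ftl.
  have : \sum_(0 <= m < N) a m * (1 - h) ^+ m <= l.
    apply: le_trans ftl; rewrite -lee_fin -af// -sumEFin.
    apply: nneseries_lim_ge => m _ _; rewrite lee_fin mulr_ge0// exprn_ge0//.
    by have /andP[] := t01.
  suff : \sum_(0 <= m < N) a m - h * K <= \sum_(0 <= m < N) a m * (1 - h) ^+ m by lra.
  apply: (@le_trans _ _ (\sum_(0 <= m < N) (a m - h * (a m * m%:R)))).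
    by rewrite sumrB -mulr_sumr lerD2l lerN2 ler_wpM2l ?(ltW h0)// /K lerDl.
  apply: ler_sum => m _; rewrite mulrCA -{1}(mulr1 (a m)) -mulrBr ler_wpM2l//.
  elim: m => [|m IH]; first by rewrite mulr0 subr0 expr0.
  rewrite exprS; have : (1 - h) * (1 - h * m%:R) <= (1 - h) * (1 - h) ^+ m.
    by rewrite ler_wpM2l//; have /andP[] := t01.
  apply: le_trans; rewrite -natr1.
  suff : 0 <= h * h * m%:R by lra.
  by rewrite !mulr_ge0// ltW.
(* Conversely, a sum below [l] would be exceeded by some [f t], although [f t] is termwise at most
   the sum at 1. *)
rewrite leNgt; apply/negP => sl.
have s0 : (0 <= \sum_(m <oo) (a m)%:E)%E.
  by apply: nneseries_ge0 => m _ _; rewrite lee_fin.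
have sE : (\sum_(m <oo) (a m)%:E = (fine (\sum_(m <oo) (a m)%:E))%:E)%E.
  by rewrite fineK// ge0_fin_numE// (lt_le_trans sl)// leey.
move: sl; rewrite sE => /lf[t t01]; apply/negP; rewrite -leNgt.
rewrite -lee_fin -sE -af//; apply: lee_nneseries => [m _ _|m _].
  by rewrite lee_fin mulr_ge0// exprn_ge0//; have /andP[] := t01.
have /andP[t0 t1] := t01.
by rewrite lee_fin ler_piMr// exprn_ile1// ltW.
Unshelve. all: by end_near. Qed.

Definition lncoef (m : nat) : R := m%:R^-1.

(** Geometric sum: the remainder of the series of [- ln (1 - x)] thus has derivative
    [x ^+ N / (1 - x)]. *)
Lemma dpsum_lncoef N x : (1 - x) * dpsum lncoef N.+1 x = 1 - x ^+ N.
Proof.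
rewrite /dpsum big_ord_recl /= mul0r mulr0 add0r.
rewrite (_ : \sum_(i < N) _ = \sum_(i < N) x ^+ i).
  by rewrite -[RHS]opprB subrX1 -mulNr opprB.
apply: eq_bigr => i _; rewrite /lncoef /bump /= add1n mulrA.
by rewrite mulVf ?pnatr_eq0// mul1r.
Qed.

Lemma psum_lncoef_bound N t : 0 <= t < 1 ->
  0 <= - ln (1 - t) - psum lncoef N.+1 t <= (1 - t)^-1 * t ^+ N.
Proof.
move=> /andP[t0 t1].
pose F := (fun x => - ln (1 - x) - psum lncoef N.+1 x).
have F0 : F 0 = 0.
  rewrite /F subr0 ln1 oppr0 sub0r /psum big_ord_recl /lncoef invr0 mul0r add0r.
  by rewrite big1 ?oppr0// => i _; rewrite expr0n /= mulr0.
suff : 0 <= F t - F 0 <= (1 - t)^-1 * t ^+ N by rewrite F0 subr0.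
apply: (@mean_value_bound _ (fun x => x ^+ N / (1 - x))).
- by rewrite t0 ltW.
- move=> x /andP[x0 xt]; have x1 : 0 < 1 - x by lra.
  have d1 : is_derive x 1 (fun y : R => 1 - y) (-1).
    have := is_deriveB (is_derive_cst (1 : R) x 1) (is_derive_id x 1).
    by move/is_derive_eq; apply; rewrite sub0r.
  have dl : is_derive x 1 (fun y => ln (1 - y)) (- (1 - x)^-1).
    have := @is_derive1_comp _ _ _ x _ _ (is_derive1_ln x1) d1.
    by move/is_derive_eq; apply; rewrite mulrN1.
  apply: (is_derive_eq (is_deriveB (is_deriveN dl) (is_derive_psum _ _ _))).
  have x10 : 1 - x != 0 by rewrite gt_eqF.
  apply: (mulfI x10); rewrite mulrBr dpsum_lncoef opprK divff// mulrCA divff//.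
  by rewrite mulr1; ring.
- move=> x /andP[x0 xt]; have x1 : 0 < 1 - x by lra.
  rewrite divr_ge0 ?exprn_ge0 ?(ltW x1)//= mulrC.
  apply: ler_pM; rewrite ?invr_ge0 ?exprn_ge0 ?(ltW x1)//.
    by rewrite lef_pV2 ?posrE ?lerB//; lra.
  by apply: lerXn2r => //; rewrite nnegrE.
Qed.


Lemma eseries_lncoef t : 0 <= t <= 1 ->
  (\sum_(m <oo) (lncoef m * t ^+ m)%:E = - lnE (1 - t))%E.
Proof.
have lt1 u : 0 <= u < 1 ->
    (\sum_(m <oo) (lncoef m * u ^+ m)%:E = (- ln (1 - u))%:E)%E.
  move=> u01; apply: eseries_psum; rewrite -(cvg_shiftn 1).
  apply: (@cvg_geometric_bound _ _ u (1 - u)^-1) => // N.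
  by rewrite /= addn1; exact: psum_lncoef_bound.
move=> /andP[t0]; rewrite le_eqVlt => /predU1P[->|t1]; last first.
  by rewrite lt1 ?t0// /lnE subr_eq0 gt_eqF.
rewrite subrr /lnE eqxx /=.
under eq_eseriesr do rewrite expr1n mulr1.
apply: (@eseries_at_one _ (fun u => - ln (1 - u))) => // [m|u _|r _].
- by rewrite invr_ge0.
- exact: leey.
- exists (1 - expR (- (`|r| + 1))); last first.
    by rewrite opprB addrC subrK expRK opprK; have := ler_norm r; lra.
  apply/andP; split; last by have := expR_gt0 (- (`|r| + 1)); lra.
  by rewrite subr_ge0 expR_le1 oppr_le0 addr_ge0.
Qed.

(** Taylor coefficients of [(1 - x) ^ s], that is, [(-1)^m] times the binomial coefficient of [s]
    and [m]. *)
Definition bincoef s m : R := \prod_(k < m) ((k%:R - s) / k.+1%:R).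

Definition powcoef s m : R := if m is 0 then 0 else - bincoef s m.

Lemma bincoefS s m : bincoef s m.+1 * m.+1%:R = (m%:R - s) * bincoef s m.
Proof. by rewrite /bincoef big_ord_recr /= -mulrA divfK ?pnatr_eq0// mulrC. Qed.

(** Truncated form of the equation [(1 - x) f' + s f = 0] satisfied by [(1 - x) ^ s]: all terms
    telescope except the top one. *)
Lemma psum_bincoef_ode s N x :
  (1 - x) * dpsum (bincoef s) N.+1 x + s * psum (bincoef s) N.+1 x =
  (s - N%:R) * bincoef s N * x ^+ N.
Proof.
elim: N => [|N IH].
  rewrite /dpsum /psum !big_ord_recl !big_ord0 /bincoef big_ord0 /=; ring.
rewrite /dpsum /psum big_ord_recr [X in _ + s * X]big_ord_recr /=.
rewrite -/(dpsum _ _ _) -/(psum _ _ _) !mulrDr addrACA IH.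
have -> : (1 - x) * (bincoef s N.+1 * (N.+1%:R * x ^+ N)) =
  (1 - x) * (bincoef s N.+1 * N.+1%:R) * x ^+ N by ring.
have -> : (s - N.+1%:R) * bincoef s N.+1 * x ^+ N.+1 =
  s * bincoef s N.+1 * x ^+ N.+1 - bincoef s N.+1 * N.+1%:R * x ^+ N.+1 by ring.
by rewrite bincoefS exprS; ring.
Qed.

Section powcoef.
Variable s : R.
Hypothesis s01 : 0 < s < 1.

Lemma bincoef_lt0 m : bincoef s m.+1 < 0.
Proof.
have /andP[s0 s1] := s01.
elim: m => [|m IH].
  by rewrite /bincoef big_ord_recr big_ord0 /= mul1r sub0r divr1 oppr_lt0.
rewrite /bincoef big_ord_recr /= pmulr_llt0//.
by rewrite divr_gt0// subr_gt0 (lt_le_trans s1)// ler1n.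
Qed.

Lemma powcoef_gt0 m : 0 < powcoef s m.+1.
Proof. by rewrite /powcoef oppr_gt0 bincoef_lt0. Qed.

Lemma powcoef_ge0 m : 0 <= powcoef s m.
Proof. by case: m => // m; exact/ltW/powcoef_gt0. Qed.

(** By [bincoefS] the left side decreases in [m]. The bound is uniform, so the remainder estimate
    stays geometric. *)
Lemma powcoef_le m : m.+1%:R * powcoef s m.+1 <= s.
Proof.
have /andP[s0 s1] := s01.
elim: m => [|m IH].
  by rewrite /powcoef /bincoef big_ord_recr big_ord0 /= mul1r; lra.
apply: le_trans IH; have := powcoef_gt0 m.
rewrite /powcoef mulrN mulrC bincoefS -mulrN => h.
by rewrite ler_wpM2r ?(ltW h)//; lra.
Qed.

Lemma psum_powcoef N t :
  psum (powcoef s) N.+1 t = 1 - psum (bincoef s) N.+1 t.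
Proof.
rewrite /psum !big_ord_recl /= /bincoef big_ord0 mul0r add0r expr0 mulr1.
rewrite opprD addrA subrr add0r -sumrN.
by apply: eq_bigr => i _; rewrite mulNr.
Qed.

Lemma psum_powcoef_bound N t : 0 <= t < 1 ->
  0 <= 1 - (1 - t) `^ s - psum (powcoef s) N.+2 t <=
  (s * (1 - t) `^ s * (1 - t) `^ (- s - 1)) * t ^+ N.
Proof.
have /andP[s0 s1] := s01; move=> /andP[t0 t1].
(* Dividing the partial sum by its expected limit leaves a function equal to 1 at 0, whose
   derivative by the truncated equation is the top term times [(1 - x) ^ (- s - 1)]. *)
pose Q := psum (bincoef s) N.+2 * (fun x => (1 - x) `^ (- s)).
have Q0 : Q 0 = 1.
  rewrite /Q fctE subr0 powR1 mulr1 /psum big_ord_recl /bincoef big_ord0 mul1r.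
  by rewrite big1 ?addr0// => i _; rewrite expr0n /= mulr0.
have QE : 1 - (1 - t) `^ s - psum (powcoef s) N.+2 t = (1 - t) `^ s * (Q t - Q 0).
  rewrite Q0 mulrBr mulr1 /Q fctE mulrCA -powRD; last first.
    by rewrite subrr eqxx /= gt_eqF// subr_gt0.
  by rewrite subrr powRr0 mulr1 psum_powcoef; ring.
have : 0 <= Q t - Q 0 <= s * (1 - t) `^ (- s - 1) * t ^+ N.
  apply: (@mean_value_bound _ (fun x =>
      (1 - x) `^ (- s - 1) * ((s - N.+1%:R) * bincoef s N.+1 * x ^+ N.+1))).
  - by rewrite t0 ltW.
  - move=> x /andP[x0 xt]; have x1 : 0 < 1 - x by lra.
    have d1 : is_derive x 1 (fun y : R => 1 - y) (-1).
      have := is_deriveB (is_derive_cst (1 : R) x 1) (is_derive_id x 1).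
      by move/is_derive_eq; apply; rewrite sub0r.
    have dp : is_derive x 1 (fun y => (1 - y) `^ (- s)) (s * (1 - x) `^ (- s - 1)).
      have := @is_derive1_comp _ _ _ x _ _ (is_derive1_powR (- s) x1) d1.
      by move/is_derive_eq; apply; ring.
    apply: (is_derive_eq (is_deriveM (is_derive_psum _ _ _) dp)).
    rewrite -psum_bincoef_ode /GRing.scale /=.
    have -> : (1 - x) `^ (- s) = (1 - x) * (1 - x) `^ (- s - 1).
      rewrite -{2}(powRr1 (ltW x1)) -powRD; last by rewrite (gt_eqF x1) implybT.
      by congr (_ `^ _); ring.
    by ring.
  - move=> x /andP[x0 xt]; have x1 : 0 < 1 - x by lra.
    have Ns : 0 < N.+1%:R - s by rewrite subr_gt0 (lt_le_trans s1)// ler1n.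
    have aN := powcoef_gt0 N.
    have -> : (s - N.+1%:R) * bincoef s N.+1 * x ^+ N.+1 =
      (N.+1%:R - s) * powcoef s N.+1 * x ^+ N.+1 by rewrite /powcoef; ring.
    rewrite !mulr_ge0 ?powR_ge0 ?exprn_ge0 ?(ltW Ns) ?(ltW aN)//=.
    rewrite [leRHS](_ : _ = (1 - t) `^ (- s - 1) * (s * t ^+ N)); last by ring.
    have c0 : 0 <= (N.+1%:R - s) * powcoef s N.+1 by rewrite mulr_ge0 ?ltW.
    apply: ler_pM; rewrite ?powR_ge0 ?(mulr_ge0 c0) ?exprn_ge0//.
      rewrite -opprD !powRN lef_pV2 ?posrE ?powR_gt0//; last lra.
      by apply: ge0_ler_powR; rewrite ?nnegrE; lra.
    apply: ler_pM; rewrite ?exprn_ge0//.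
      apply: le_trans (powcoef_le N); rewrite ler_wpM2r ?(ltW aN)//; lra.
    rewrite exprSr -[leRHS]mulr1; apply: ler_pM; rewrite ?exprn_ge0//; last lra.
    by apply: lerXn2r; rewrite ?nnegrE//; lra.
rewrite QE => /andP[h1 h2]; rewrite mulr_ge0 ?powR_ge0//=.
rewrite [leRHS](_ : _ = (1 - t) `^ s * (s * (1 - t) `^ (- s - 1) * t ^+ N)).
  by rewrite ler_wpM2l ?powR_ge0.
by ring.
Qed.

Lemma eseries_powcoef t : 0 <= t <= 1 ->
  (\sum_(m <oo) (powcoef s m * t ^+ m)%:E = (1 - (1 - t) `^ s)%:E)%E.
Proof.
have /andP[s0 s1] := s01.
have lt1 u : 0 <= u < 1 ->
    (\sum_(m <oo) (powcoef s m * u ^+ m)%:E = (1 - (1 - u) `^ s)%:E)%E.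
  move=> u01; apply: eseries_psum; rewrite -(cvg_shiftn 2).
  apply: (@cvg_geometric_bound _ _ u (s * (1 - u) `^ s * (1 - u) `^ (- s - 1))) => // N.
  by rewrite /= addn2; exact: psum_powcoef_bound.
move=> /andP[t0]; rewrite le_eqVlt => /predU1P[->|t1]; last by rewrite lt1 ?t0.
rewrite subrr powR0 ?gt_eqF// subr0.
under eq_eseriesr do rewrite expr1n mulr1.
apply: (@eseries_at_one _ (fun u => 1 - (1 - u) `^ s)) => // [m|u _|r].
- exact: powcoef_ge0.
- by rewrite lee_fin gerBl powR_ge0.
(* At [t = 1 - c ^ (1/s)] the function equals [1 - c], which exceeds [r]; [c <= 1] ensures
   [t >= 0]. *)
- rewrite lte_fin => r1; pose c := Num.min 1 ((1 - r) / 2).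
  have c0 : 0 < c by rewrite lt_min ltr01 divr_gt0// subr_gt0.
  have c1 : c <= 1 by rewrite ge_min lexx.
  have cr : c <= (1 - r) / 2 by rewrite ge_min lexx orbT.
  have cs0 : 0 < c `^ s^-1 by exact: powR_gt0.
  have cs1 : c `^ s^-1 <= 1.
    have E : 1 `^ s^-1 = 1 :> R by rewrite powR1.
    rewrite -[leRHS]E; apply: ge0_ler_powR => //.
    - by rewrite invr_ge0 ltW.
    - by rewrite nnegrE ltW.
    - by rewrite nnegrE.
  exists (1 - c `^ s^-1); first by apply/andP; split; lra.
  rewrite (_ : 1 - (1 - c `^ s^-1) = c `^ s^-1); last by ring.
  rewrite -powRrM mulVf ?gt_eqF// powRr1 ?(ltW c0)//.
  by lra.
Qed.

End powcoef.
End power_series.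

(** * Finiteness of the logarithmic energy *)

Section log_energy.
Variables (R : realType) (H : Hfield) (n : nat).
Local Notation C := R[i].
Local Notation d := n.+2.
Local Notation grm := (gram (@entry R H n)).

Definition plane_scale (a : R) : R := (Num.sqrt (1 + a ^+ 2))^-1.

(** Unit vector of slope [a] in the real coordinate plane of the first two axes, available over both
    fields. Parametrising by slope makes the kernel a rational function. *)
Definition plane_vec (a : R) : 'cV[C]_d :=
  \col_k (plane_scale a * (if k == ord0 then 1
                           else if k == lift ord0 ord0 then a else 0))%:C%C.

Lemma plane_scale_sqr a : plane_scale a ^+ 2 = (1 + a ^+ 2)^-1.
Proof. by rewrite /plane_scale exprVn sqr_sqrtr// addr_ge0 ?sqr_ge0. Qed.

Lemma plane_vec_dot a b : adj (plane_vec a) *m plane_vec b =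
  (plane_scale a * plane_scale b * (1 + a * b))%:C%C%:M.
Proof.
rewrite [LHS]mx11_scalar; congr (_%:M).
rewrite mxE !big_ord_recl big1 => [|k _]; rewrite !mxE /=.
  by apply/eqP; rewrite eq_complex /=; apply/andP; split; apply/eqP; ring.
by apply/eqP; rewrite eq_complex /=; apply/andP; split; apply/eqP; ring.
Qed.

Lemma sphere_plane_vec a : @sphere R H n (plane_vec a).
Proof.
split; first by apply/mxHP => i j; rewrite mxE; exact: inH_real.
apply: (@complexI R); have := plane_vec_dot a a; rewrite adj_normsq.
move=> /matrixP/(_ ord0 ord0); rewrite !mxE /= !mulr1n => ->.
rewrite -!expr2 plane_scale_sqr mulVf// gt_eqF//.
by rewrite ltr_wpDr ?sqr_ge0.
Qed.

Definition plane_line a : GrB R H n := line (sphere_plane_vec a).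

Lemma gram_plane_line a b : grm (plane_line a) (plane_line b) =
  (1 + a * b) ^+ 2 / ((1 + a ^+ 2) * (1 + b ^+ 2)).
Proof.
rewrite gram_line /= -mulmxA plane_vec_dot mul_mx_scalar.
apply: (@complexI R); have := adj_normsq
  ((plane_scale a * plane_scale b * (1 + a * b))%:C%C *: plane_vec a).
move=> /matrixP/(_ ord0 ord0); rewrite [in RHS]mxE /= mulr1n => <-.
rewrite adj_scale -scalemxAl -scalemxAr adj_normsq (sphere_plane_vec a).2 scalerA.
rewrite !mxE /= mulr1n mulr1 oppr0.
rewrite -[X in X * _]/((plane_scale a * plane_scale b * (1 + a * b))%:C)%C.
rewrite -rmorphM /= invfM -!plane_scale_sqr; congr (_%:C)%C; ring.
Qed.

(** Lagrange's identity [(1 + a b)^2 = (1 + a^2)(1 + b^2) - (a - b)^2], with a denominator of at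
    most 4. *)
Lemma gram_plane_line_le a b : 0 <= a <= 1 -> 0 <= b <= 1 ->
  grm (plane_line a) (plane_line b) <= 1 - (a - b) ^+ 2 / 4.
Proof.
move=> /andP[a0 a1] /andP[b0 b1]; rewrite gram_plane_line.
have A0 : 1 <= 1 + a ^+ 2 <= 2.
  by rewrite lerDl sqr_ge0 /=; have := exprn_ile1 2 a0 a1; lra.
have B0 : 1 <= 1 + b ^+ 2 <= 2.
  by rewrite lerDl sqr_ge0 /=; have := exprn_ile1 2 b0 b1; lra.
have D0 : 0 < (1 + a ^+ 2) * (1 + b ^+ 2) by rewrite mulr_gt0//; lra.
have D4 : (1 + a ^+ 2) * (1 + b ^+ 2) <= 4.
  rewrite (_ : 4 = 2 * 2); last by ring.
  by apply: ler_pM; lra.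
have -> : (1 + a * b) ^+ 2 / ((1 + a ^+ 2) * (1 + b ^+ 2)) =
    1 - (a - b) ^+ 2 / ((1 + a ^+ 2) * (1 + b ^+ 2)).
  have -> : (1 + a * b) ^+ 2 = (1 + a ^+ 2) * (1 + b ^+ 2) - (a - b) ^+ 2 by ring.
  by rewrite mulrBl divff// gt_eqF.
rewrite lerD2l lerN2; apply: ler_wpM2l; first exact: sqr_ge0.
by rewrite lef_pV2 ?posrE.
Qed.

Lemma expr1B_le (x : R) m : 0 <= x <= 1 -> (1 - x) ^+ m * (m%:R * x) <= 1.
Proof.
move=> /andP[x0 x1].
suff : (1 - x) ^+ m * (1 + m%:R * x) <= 1.
  by apply: le_trans; rewrite ler_wpM2l ?exprn_ge0 ?subr_ge0//; lra.
elim: m => [|m IH]; first by rewrite mul0r addr0 mulr1.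
apply: le_trans IH; rewrite exprSr -mulrA ler_wpM2l ?exprn_ge0 ?subr_ge0//.
rewrite -natr1; suff : 0 <= (m%:R + 1) * x * x by lra.
by rewrite !mulr_ge0// addr_ge0.
Qed.

Variable Gam : probability (GrB R H n) R.
Hypothesis hGam : Gr_invariant Gam.

Definition inv_moment m : R := moment (@entry R H n) m Gam (plane_line 0).

Lemma inv_momentE m V : moment (@entry R H n) m Gam V = inv_moment m.
Proof. exact: invariant_moment. Qed.

Lemma inv_moment_le m p : (m <= p)%N -> inv_moment p <= inv_moment m.
Proof.
move=> mp; apply: le_Rintegral => //.
- by apply: integrable_gramX; [exact: measurable_entry|exact: gramVV|exact: gram_ge0|].
- by apply: integrable_gramX; [exact: measurable_entry|exact: gramVV|exact: gram_ge0|].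
- move=> V _; rewrite -(subnK mp) exprD; apply: ler_piMl.
    by apply: exprn_ge0; exact: gram_ge0.
  exact: (gramX_le1 (@gramVV R H n) (@gram_ge0 R H n)).
Qed.

(* Comparing the invariant energy with that of [2 ^ j] equally weighted lines
   in a plane, whose mutual angles are at least of order [2 ^- j]. *)
Lemma inv_moment_decay j : inv_moment (8 ^ j) <= 5 / 2 ^+ j.
Proof.
pose N := (2 ^ j)%N; pose c : R := 2 ^+ j.
have c0 : 0 < c by rewrite exprn_gt0.
have NE : N%:R = c by rewrite /N natrX.
have c1 : 1 <= c by rewrite exprn_ege1// ler1n.
have := @discrete_energy_ge _ _ _ _ _ (@measurable_entry R H n) (@gramVV R H n) (8 ^ j)
  Gam (inv_moment (8 ^ j)) (inv_momentE _) N (fun i => plane_line (i%:R / c)).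
rewrite NE => dE.
(* Distinct slopes differ by at least [1 / c], so off the diagonal the kernel is at most [1 - x].
   The exponent [8 ^ j = c ^ 3] gives [m x = c / 4], and the power is at most [4 / c]. *)
pose x : R := (4 * c ^+ 2)^-1.
have x0 : 0 < x by rewrite invr_gt0 mulr_gt0// exprn_gt0.
have x1 : x <= 1.
  rewrite invf_le1 ?mulr_gt0 ?exprn_gt0//.
  by have := exprn_ege1 2 c1; lra.
have qE : (1 - x) ^+ (8 ^ j) <= 4 / c.
  have := @expr1B_le x (8 ^ j) _; rewrite ltW//= x1 => /(_ isT).
  have -> : (8 ^ j)%:R * x = c / 4.
    have -> : (8 ^ j)%:R = c ^+ 3 :> R.
      by rewrite /c -exprM mulnC exprM natrX; congr (_ ^+ _); ring.
    by rewrite /x; field; rewrite gt_eqF.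
  by rewrite -ler_pdivlMr ?divr_gt0// invf_div mul1r.
(* The diagonal contributes [c] and the other pairs at most [4 c]; hence the constant 5. *)
have : c ^+ 2 * inv_moment (8 ^ j) <= c + c ^+ 2 * (4 / c).
  apply: le_trans dE _.
  apply: (@le_trans _ _ (\sum_(i < N) \sum_(k < N) ((i == k)%:R + 4 / c))).
    apply: ler_sum => i _; apply: ler_sum => k _.
    have [->|ik] := eqVneq i k.
      rewrite (le_trans (gramX_le1 (@gramVV R H n) (@gram_ge0 R H n) _ _ _))//.
      by rewrite lerDl divr_ge0// ltW.
    rewrite add0r; apply: le_trans qE; apply: lerXn2r.
    - by rewrite nnegrE gram_ge0.
    - by rewrite nnegrE subr_ge0.
    - have in01 (l : 'I_N) : 0 <= l%:R / c <= 1.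
        rewrite divr_ge0 ?(ltW c0)//= ler_pdivrMr// mul1r -NE ler_nat.
        exact: ltnW.
      apply: le_trans (gram_plane_line_le (in01 i) (in01 k)) _.
      have far : 1 <= (i%:R - k%:R) ^+ 2 :> R.
        have lt_far (u v : nat) : (u < v)%N -> 1 <= (u%:R - v%:R) ^+ 2 :> R.
          rewrite -(ler_nat R) -natr1 => uv; nra.
        have [ik'|ki|/val_inj ik'] := ltngtP i k; first exact: lt_far.
          by rewrite -sqrrN opprB; exact: lt_far.
        by rewrite ik' eqxx in ik.
      have -> : (i%:R / c - k%:R / c) ^+ 2 / 4 = (i%:R - k%:R) ^+ 2 * x.
        by rewrite /x; field; rewrite gt_eqF.
      by rewrite lerD2l lerN2 ler_peMl// ltW.
  have sumk (i : 'I_N) : \sum_(k < N) ((i == k)%:R + 4 / c) = 1 + c * (4 / c).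
    rewrite big_split /= sumr_const card_ord -[X in _ + X]mulr_natl NE.
    by rewrite (bigD1 i)//= eqxx big1 ?addr0// => k /negPf; rewrite eq_sym => ->.
  under eq_bigr do rewrite sumk.
  rewrite sumr_const card_ord -[leLHS]mulr_natl NE.
  by rewrite le_eqVlt; apply/orP; left; apply/eqP; ring.
rewrite -ler_pdivlMl ?exprn_gt0//; move/le_trans; apply.
rewrite -/c le_eqVlt; apply/orP; left; apply/eqP; field.
by rewrite gt_eqF.
Qed.

Lemma log_energy_finite : (min_energy (@lncoef R) inv_moment < +oo)%E.
Proof.
have i0 m : 0 <= inv_moment m by apply: moment_ge0; exact: gram_ge0.
have l0 m : 0 <= @lncoef R m by rewrite invr_ge0.
(* The block from [8 ^ j] to [8 ^ j.+1] has [7 * 8 ^ j] terms, each at most [8 ^- j * 5 / 2 ^ j]. It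
   adds at most [35 / 2 ^ j], and these bounds sum to 70. *)
have block j : \sum_(0 <= m < 8 ^ j) @lncoef R m * inv_moment m <= 70 * (1 - 2 ^- j).
  elim: j => [|j IH].
    by rewrite big_nat1 /lncoef invr0 mul0r expr0 invr1 subrr mulr0.
  rewrite (@big_cat_nat _ _ _ (8 ^ j)) //=; last by rewrite leq_exp2l.
  have : \sum_(8 ^ j <= m < 8 ^ j.+1) @lncoef R m * inv_moment m <= 7 * (5 / 2 ^+ j).
    have e0 : 0 < (8 ^ j)%:R :> R by rewrite ltr0n expn_gt0.
    apply: (@le_trans _ _ (\sum_(8 ^ j <= m < 8 ^ j.+1) ((8 ^ j)%:R^-1 * (5 / 2 ^+ j)))).
      apply: ler_sum_nat => m /andP[jm _]; apply: ler_pM => //.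
        rewrite lef_pV2 ?posrE ?ler_nat// ltr0n (leq_trans _ jm)//.
        by rewrite expn_gt0.
      exact: le_trans (inv_moment_le jm) (inv_moment_decay j).
    rewrite sumr_const_nat -[leLHS]mulr_natl natrB; last by rewrite leq_exp2l.
    rewrite expnS natrM mulrA ler_wpM2r ?divr_ge0 ?exprn_ge0//.
    rewrite mulrBl mulfK ?gt_eqF// divff ?gt_eqF//; lra.
  move: IH; rewrite exprS invfM; lra.
apply: (@le_lt_trans _ _ 70%:E); last exact: ltry.
apply: lime_le.
  by apply: is_cvg_nneseries => m _ _; rewrite lee_fin mulr_ge0.
near=> N; rewrite sumEFin lee_fin.
apply: (@le_trans _ _ (\sum_(0 <= m < 8 ^ N) @lncoef R m * inv_moment m)).
  rewrite [leRHS](@big_cat_nat _ _ _ N) //=; last exact/ltnW/ltn_expl.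
  by rewrite lerDl sumr_ge0// => m _; rewrite mulr_ge0.
apply: le_trans (block N) _.
have h : 0 <= (2 : R) ^- N by rewrite invr_ge0 exprn_ge0.
lra.
Unshelve. all: by end_near. Qed.

End log_energy.

(** * Minimizers *)

Lemma lee_sub_swap (R : realType) (c : R) (x y : \bar R) :
  (c%:E - x <= y -> c%:E - y <= x)%E.
Proof.
case: x y => [x||] [y||] //=; rewrite -?EFinN -?EFinD ?lee_fin ?leey ?leNye//.
by lra.
Qed.

Section minimizers.
Variables (R : realType) (H : Hfield) (n : nat).
Local Notation ent := (@entry R H n).
Local Notation mentry := (@measurable_entry R H n).
Local Notation gVV := (@gramVV R H n).
Local Notation gge0 := (@gram_ge0 R H n).
Variable Gam : probability (GrB R H n) R.
Hypothesis hGam : Gr_invariant Gam.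
Local Notation g := (inv_moment Gam).

Section potential_to_minimizer.
Variables (a : nat -> R) (c : R) (u : probability (GrB R H n) R -> 'cV[R[i]]_n.+2 -> \bar R).
Hypothesis a_ge0 : forall m, 0 <= a m.
Hypothesis a_gt0 : forall m, 0 < a m.+1.
Hypothesis energy_fin : (min_energy a g < +oo)%E.
Hypothesis uE : forall mu x (Sx : @sphere R H n x),
  (u mu x = c%:E - potential ent a mu (line Sx))%E.

(** Common to both kernels, with [c = 1] for the power and [c = 0] for the logarithm: minimising the
    supremum of [u] means maximising the infimum of the potential. *)
Lemma unique_minimizer_potential :
  unique_minimizer (fun mu => ereal_sup [set u mu x | x in @sphere R H n]) Gam.
Proof.
pose E := min_energy a g.
pose F mu := ereal_sup [set u mu x | x in @sphere R H n].
have mom m V : moment ent m Gam V = g m by exact: inv_momentE.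
have ball V (e : R) : 0 < e -> (0 < Gam (gram_ball ent V (1 - e)))%E.
  by apply: gram_ball_gt0; [exact: mentry|exact: gVV|exact: invariant_ball].
have E0 : (0 <= E)%E.
  rewrite /E -(potential_invariant a mom (plane_line H n 0)).
  by apply: potential_ge0; [exact: gge0|].
have FGam : (F Gam <= c%:E - E)%E.
  apply: ub_ereal_sup => _ [x Sx <-].
  by rewrite (uE Gam Sx) (potential_invariant a mom).
have pF mu V : (c%:E - potential ent a mu V <= F mu)%E.
  have [x [Sx ->]] := line_surj V; rewrite -uE.
  by apply: ereal_sup_ubound; exists x.
split=> [nu|mu muF].
  apply: le_trans FGam _; apply: lee_sub_swap.
  (* The lower bound used for the potential of [nu] is [c - F nu]. *)
  apply: (potential_le_min_energy mentry gVV gge0 a_ge0 mom (mu := nu)).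
  - rewrite sube_ge0 ?orbT//.
    apply: ub_ereal_sup => _ [x Sx <-]; rewrite (uE nu Sx).
    by apply: lee_sub_swap; rewrite subee// potential_ge0//; exact: gge0.
  - by move=> V; apply: lee_sub_swap; exact: pF.
have Ep V : (E <= potential ent a mu V)%E.
  have : (c%:E - potential ent a mu V <= c%:E - E)%E.
    by apply: le_trans (pF mu V) _; apply: le_trans (muF Gam) FGam.
  have -> : E = (fine E)%:E by rewrite fineK// ge0_fin_numE.
  move=> /lee_sub_swap; suff -> : (c%:E - (c%:E - (fine E)%:E) = (fine E)%:E)%E by [].
  have ce : c - (c - fine E) = fine E by rewrite opprB addrC subrK.
  exact: (congr1 EFin ce).
have momu := potential_unique mentry gVV gge0 a_ge0 a_gt0 ball mom energy_fin Ep.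
move=> A mA; apply: (moment_determines mentry gVV gge0 ball mom) => //.
exact: measurable_GrB.
Qed.

End potential_to_minimizer.

Lemma gram_lineC x (Sx : @sphere R H n x) (W : GrB R H n) :
  normsq (sval W *m x) = gram ent (line Sx) W.
Proof. by rewrite gramC gram_line. Qed.

Section power.
Variable s : R.
Hypothesis s01 : 0 < s < 1.

(** Written as a sum of two nonnegative quantities so that no infinite value is subtracted; it also
    shows that the potential is at most 1, hence that the minimal energy is finite. *)
Lemma integral_alpha_s (mu : probability (GrB R H n) R) x (Sx : @sphere R H n x) :
  (\int[mu]_W (alpha_s s W x)%:E + potential ent (powcoef s) mu (line Sx) = 1)%E.
Proof.
rewrite -(integral_gram_series mentry gVV gge0 (powcoef_ge0 s01)).
rewrite -ge0_integralD//=.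
- under eq_integral => W _.
    rewrite eseries_powcoef//; last by rewrite gge0 (gram_le1 gVV).
    rewrite -EFinD /alpha_s (gram_lineC Sx) addrC subrK.
    over.
  by rewrite integral_cst// mul1e; exact: probability_setT.
- by move=> W _; rewrite lee_fin powR_ge0.
- apply/measurable_EFinP; apply: (measurableT_comp (measurable_powR s)).
  rewrite (_ : (fun W => _) = (fun W => 1 - gram ent (line Sx) W)).
    by apply: measurable_funB => //; exact: (measurable_gram mentry).
  by apply/funext => W; rewrite (gram_lineC Sx).
- move=> W _; apply: nneseries_ge0 => m _ _.
  by rewrite lee_fin mulr_ge0 ?powcoef_ge0 ?exprn_ge0 ?gge0.
- apply: ge0_emeasurable_sum => m; first move=> W _ _.
    by rewrite lee_fin mulr_ge0 ?powcoef_ge0 ?exprn_ge0 ?gge0.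
  move=> _; apply/measurable_EFinP; apply: measurable_funM => //.
  exact: (measurable_gramX mentry).
Qed.

Lemma unique_minimizer_power : unique_minimizer (@F_s R H n s) Gam.
Proof.
have pot_le1 (mu : probability (GrB R H n) R) x (Sx : @sphere R H n x) :
    (potential ent (powcoef s) mu (line Sx) <= 1)%E.
  rewrite -(integral_alpha_s mu Sx) leeDr//.
  by apply: integral_ge0 => W _; rewrite lee_fin powR_ge0.
apply: (@unique_minimizer_potential (powcoef s) 1
  (fun mu x => \int[mu]_W (alpha_s s W x)%:E)%E).
- exact: powcoef_ge0.
- exact: powcoef_gt0.
- rewrite -(potential_invariant (powcoef s) (inv_momentE hGam) (plane_line H n 0)).
  exact: le_lt_trans (pot_le1 _ _ _) (ltry 1).
- move=> mu x Sx; rewrite -(integral_alpha_s mu Sx) addeK//.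
  rewrite ge0_fin_numE; first exact: le_lt_trans (pot_le1 _ _ _) (ltry 1).
  by apply: potential_ge0; [exact: gge0|exact: powcoef_ge0].
Qed.

End power.

Lemma unique_minimizer_log : unique_minimizer (@F_log R H n) Gam.
Proof.
have l0 m : 0 <= @lncoef R m by rewrite invr_ge0.
apply: (@unique_minimizer_potential (@lncoef R) 0
  (fun mu x => \int[mu]_W (alpha_log W x))%E) => //.
- by move=> m; rewrite invr_gt0 ltr0n.
- exact: log_energy_finite.
- move=> mu x Sx; rewrite sub0e.
  rewrite -(integral_gram_series mentry gVV gge0 l0).
  rewrite -integral_ge0N; last first.
    move=> W _; apply: nneseries_ge0 => m _ _.
    by rewrite lee_fin mulr_ge0 ?exprn_ge0 ?gge0.
  apply: eq_integral => W _.
  rewrite eseries_lncoef ?oppeK; last by rewrite gge0 (gram_le1 gVV).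
  by rewrite /alpha_log (gram_lineC Sx).
Qed.

End minimizers.

(* H = R (Hreal) or C (Hcomplex); d = n.+2 >= 2; Gam is the invariant
   probability measure Gamma_{1,d} on G(1,d). *)
Theorem theorem5p1 (R : realType) (H : Hfield) (n : nat)
    (Gam : probability (GrB R H n) R) (hGam : Gr_invariant Gam) :
  (forall s : R, 0 < s < 1 -> unique_minimizer (F_s s) Gam) /\
  unique_minimizer (@F_log R H n) Gam.
Proof.
split=> [s s01|]; first exact: unique_minimizer_power.
exact: unique_minimizer_log.
Qed.
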